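(* Let $X$ be an indecomposable continuum in a closed surface $S$. Then there exists a sequence $(U_n)_{n=1}^\infty$ of (not necessarily distinct) complementary domains of $X$ such that $\lim_{n\to\infty}\partial U_n=X$ in the Hausdorff metric.
   Context: A continuum is a compact connected metric space; it is indecomposable if it is not the union of two proper subcontinua. A closed surface is a compact connected 2-manifold without boundary, not necessarily orientable. A complementary domain of $X\subset S$ is a component of $S\setminus X$. Limits are in the Hausdorff metric on nonempty compact subsets of $S$ (for any metric compatible with the topology of $S$). *)

(* Defs.v *)
From Stdlib Require Import Reals List.
Open Scope R_scope.

Record MetricSpace := {
  carrier :> Type;
  dist : carrier -> carrier -> R;
  dist_self : forall x, dist x x = 0;
  dist_eq0 : forall x y, dist x y = 0 -> x = y;
  dist_sym : forall x y, dist x y = dist y x;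
  dist_tri : forall x y z, dist x z <= dist x y + dist y z
}.

Arguments dist {_} _ _.

Section Topology.
Variable S : MetricSpace.

Definition subset (A B : S -> Prop) : Prop := forall x, A x -> B x.

Definition is_open (U : S -> Prop) : Prop :=
  forall x, U x -> exists r, 0 < r /\ forall y, dist x y < r -> U y.

Definition compact (K : S -> Prop) : Prop :=
  forall (I : Type) (O : I -> S -> Prop),
    (forall i, is_open (O i)) ->
    (forall x, K x -> exists i, O i x) ->
    exists l : list I, forall x, K x -> exists i, In i l /\ O i x.

Definition connected (A : S -> Prop) : Prop :=
  ~ exists U V : S -> Prop,
      is_open U /\ is_open V /\
      (forall x, A x -> U x \/ V x) /\
      (forall x, A x -> U x -> V x -> False) /\
      (exists x, A x /\ U x) /\ (exists x, A x /\ V x).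

Definition continuum (X : S -> Prop) : Prop :=
  (exists x, X x) /\ compact X /\ connected X.

Definition indecomposable (X : S -> Prop) : Prop :=
  continuum X /\
  ~ exists A B : S -> Prop,
      continuum A /\ continuum B /\ subset A X /\ subset B X /\
      (exists x, X x /\ ~ A x) /\ (exists x, X x /\ ~ B x) /\
      (forall x, X x <-> A x \/ B x).

Definition component (A C : S -> Prop) : Prop :=
  (exists x, C x) /\ subset C A /\ connected C /\
  forall D, connected D -> subset C D -> subset D A -> subset D C.

Definition complementary_domain (X U : S -> Prop) : Prop :=
  component (fun x => ~ X x) U.

Definition closure (A : S -> Prop) : S -> Prop :=
  fun x => forall r, 0 < r -> exists y, A y /\ dist x y < r.

Definition interior (A : S -> Prop) : S -> Prop :=
  fun x => exists r, 0 < r /\ forall y, dist x y < r -> A y.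

Definition boundary (A : S -> Prop) : S -> Prop :=
  fun x => closure A x /\ ~ interior A x.

Definition hausdorff_converges (A : nat -> S -> Prop) (B : S -> Prop) : Prop :=
  forall eps, 0 < eps -> exists N, forall n, (N <= n)%nat ->
    (forall x, A n x -> exists y, B y /\ dist x y < eps) /\
    (forall y, B y -> exists x, A n x /\ dist x y < eps).

End Topology.

Definition euclid (p q : R * R) : R :=
  sqrt ((fst p - fst q)^2 + (snd p - snd q)^2).

Definition continuous_on_to_R2 (S : MetricSpace) (U : S -> Prop)
  (f : S -> R * R) : Prop :=
  forall x, U x -> forall eps, 0 < eps -> exists delta, 0 < delta /\
    forall y, U y -> dist x y < delta -> euclid (f x) (f y) < eps.

Definition continuous_from_R2 (S : MetricSpace) (g : R * R -> S) : Prop :=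
  forall p eps, 0 < eps -> exists delta, 0 < delta /\
    forall q, euclid p q < delta -> dist (g p) (g q) < eps.

Definition locally_euclidean_2 (S : MetricSpace) : Prop :=
  forall x : S, exists U : S -> Prop, is_open S U /\ U x /\
    exists (f : S -> R * R) (g : R * R -> S),
      continuous_on_to_R2 S U f /\ continuous_from_R2 S g /\
      (forall y, U y -> g (f y) = y) /\
      (forall p, U (g p) /\ f (g p) = p).

(* a closed surface: a compact connected 2-manifold without boundary
   (metrizable; S carries a compatible metric) *)
Definition closed_surface (S : MetricSpace) : Prop :=
  (exists x : S, True) /\
  compact S (fun _ => True) /\ connected S (fun _ => True) /\
  locally_euclidean_2 S.

(* Main.v *)
(* If no domain has an eps-dense boundary, then finitely many balls B_i centred on X
   are such that the boundary of every domain misses some B_i. Since X is indecomposable,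
   one finds arbitrarily many points x_t of X which are pairwise separated in every
   X \ B_i, say by functions h_{i,t} : X \ B_i -> Z/2. A separation of X \ B_i defines a
   Z/2-cocycle on S supported on the frontier of the union W_i of the domains whose
   boundary misses B_i, and H^1(S; Z/2) is finite. By pigeonhole there are t <> t' such
   that, for all i, the cocycle of h_i = h_{i,t} + h_{i,t'} is trivial; as X and the
   domains are connected, h_i is then constant on the boundary of every domain in W_i.
   The same argument with a single ball, applied to X \ V1, shows that any two open sets
   V1, V2 meeting X are joined by the boundary of some domain. Taking for V1, V2 small
   neighbourhoods of x_t and of a third point x_s, where the h_i take the values 1 and 0,
   gives a contradiction. *)
From Stdlib Require Import Reals List Lra Lia Bool Classical ClassicalEpsilon.
Require Import Defs.
Import ListNotations.
Open Scope R_scope.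

(** * Truth values, finite minima of radii and metric preliminaries *)

Definition asb (P : Prop) : bool :=
  if excluded_middle_informative P then true else false.

Lemma asb_true (P : Prop) : asb P = true <-> P.
Proof.
  unfold asb. destruct (excluded_middle_informative P); split; intros; auto; discriminate.
Qed.

Lemma asb_false (P : Prop) : asb P = false <-> ~ P.
Proof.
  unfold asb. destruct (excluded_middle_informative P); split; intros; auto;
    try discriminate; contradiction.
Qed.

Lemma asb_iff (P Q : Prop) : (P <-> Q) -> asb P = asb Q.
Proof.
  intros H. unfold asb.
  destruct (excluded_middle_informative P), (excluded_middle_informative Q); tauto.
Qed.

(** Takes the place of a minimum of finitely many positive radii, for any condition that survives
    shrinking. *)
Lemma list_radius {A : Type} (l : list A) (P : A -> R -> Prop) :
  (forall a r r', P a r -> 0 < r' <= r -> P a r') ->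
  (forall a, In a l -> exists r, 0 < r /\ P a r) ->
  exists r, 0 < r /\ forall a, In a l -> P a r.
Proof.
  intros Hmon. induction l as [|a l IH]; intros H.
  - exists 1. split; [lra | intros a []].
  - destruct IH as [r [Hr Hl]]; [intros; apply H; now right |].
    destruct (H a (or_introl eq_refl)) as [r' [Hr' Ha]].
    exists (Rmin r r').
    assert (0 < Rmin r r') by now apply Rmin_glb_lt.
    pose proof (Rmin_l r r'). pose proof (Rmin_r r r').
    split; auto. intros b [<- | Hb].
    + apply Hmon with r'; auto.
    + apply Hmon with r; auto.
Qed.

Lemma dist_ge0 {M : MetricSpace} (x y : M) : 0 <= dist x y.
Proof.
  pose proof (dist_tri M x y x). rewrite dist_self, (dist_sym M y x) in H. lra.
Qed.

Lemma dist_gt0 {M : MetricSpace} (x y : M) : x <> y -> 0 < dist x y.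
Proof.
  intros H. destruct (dist_ge0 x y) as [h | h]; auto.
  symmetry in h. apply dist_eq0 in h. contradiction.
Qed.

Lemma ball_open {M : MetricSpace} (x : M) (r : R) : is_open M (fun y => dist x y < r).
Proof.
  intros y Hy. exists (r - dist x y). split; [lra |].
  intros z Hz. pose proof (dist_tri M x y z). lra.
Qed.

(** * Connectedness through locally constant functions *)

(** Continuous functions from [A] to Z/2 are encoded as total functions of which only the values on
    [A] matter; [xorb] is their addition. *)
Definition locconst {M : MetricSpace} (A : M -> Prop) (phi : M -> bool) : Prop :=
  forall x, A x -> exists r, 0 < r /\ forall y, A y -> dist x y < r -> phi y = phi x.

Definition conn {M : MetricSpace} (A : M -> Prop) : Prop :=
  forall phi, locconst A phi -> forall x y, A x -> A y -> phi x = phi y.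

(** Balls of constancy thicken the fibres of [phi] over [A] to open sets of [M]; [connected] asks
    for disjointness on [A] only, so full radii suffice. Conversely, a separation yields the
    indicator of [U]. *)
Lemma connected_conn {M : MetricSpace} (A : M -> Prop) : connected M A <-> conn A.
Proof.
  split.
  - intros H phi Hphi x y Hx Hy.
    set (O := fun b z => exists a r, A a /\ phi a = b /\
      (forall w, A w -> dist a w < r -> phi w = phi a) /\ dist a z < r).
    assert (HO : forall b, is_open M (O b)).
    { intros b z (a & r & Ha & Hb & Hr & Hz).
      destruct (ball_open a r z Hz) as [s [Hs Hs']].
      exists s. split; auto. intros w Hw. exists a, r. auto. }
    assert (HA : forall z, A z -> O (phi z) z).
    { intros z Hz. destruct (Hphi z Hz) as [r [Hr Hr']].
      exists z, r. rewrite dist_self. auto. }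
    assert (HU : forall b z, A z -> O b z -> phi z = b).
    { intros b z Hz (a & r & Ha & Hb & Hr & Hd). rewrite <- Hb. auto. }
    destruct (bool_dec (phi x) (phi y)) as [E | E]; auto. exfalso.
    apply H. exists (O (phi x)), (O (phi y)). repeat split; auto.
    + intros z Hz. generalize (HA z Hz).
      destruct (phi x), (phi y), (phi z); auto; contradiction.
    + intros z Hz H1 H2. apply HU in H1, H2; auto. congruence.
    + exists x. auto.
    + exists y. auto.
  - intros H (U & V & HU & HV & Hc & Hd & [x [Hx Ux]] & [y [Hy Vy]]).
    assert (E : asb (U x) = asb (U y)).
    { apply (H (fun z => asb (U z))); auto. intros z Hz.
      destruct (Hc z Hz) as [Uz | Vz].
      - destruct (HU z Uz) as [r [Hr Hr']]. exists r. split; auto.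
        intros w Hw Hzw. apply asb_iff. split; auto.
      - destruct (HV z Vz) as [r [Hr Hr']]. exists r. split; auto.
        intros w Hw Hzw. apply asb_iff. split; intros; exfalso; eauto. }
    apply (Hd y Hy); auto. apply asb_true. rewrite <- E. now apply asb_true.
Qed.

Lemma locconst_sub {M : MetricSpace} (A B : M -> Prop) phi :
  (forall x, A x -> B x) -> locconst B phi -> locconst A phi.
Proof.
  intros H HB x Hx. destruct (HB x (H x Hx)) as [r [Hr Hr']]. exists r. auto.
Qed.

Lemma locconst_op {M : MetricSpace} (op : bool -> bool -> bool) (A : M -> Prop) phi psi :
  locconst A phi -> locconst A psi -> locconst A (fun x => op (phi x) (psi x)).
Proof.
  intros H1 H2 x Hx. destruct (H1 x Hx) as [r [Hr Hr']], (H2 x Hx) as [s [Hs Hs']].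
  exists (Rmin r s). split; [now apply Rmin_glb_lt |].
  intros y Hy Hd. pose proof (Rmin_l r s). pose proof (Rmin_r r s).
  rewrite (Hr' y), (Hs' y); auto; lra.
Qed.

(** The indicator of a point outside [A] vanishes on [A], yet tells that point from all others; this
    keeps quasi-components inside their set. *)
Lemma locconst_outside {M : MetricSpace} (A : M -> Prop) x :
  ~ A x -> locconst A (fun z => asb (z = x)).
Proof.
  intros H y Hy. exists 1. split; [lra |]. intros z Hz _.
  apply asb_iff. split; intros ->; contradiction.
Qed.

(** If [D] missed the boundary, each of its points would be interior to [U] or off its closure, and
    the indicator of [U] would be locally constant on [D]. *)
Lemma conn_meets_boundary {M : MetricSpace} (D U : M -> Prop) x y :
  conn D -> D x -> U x -> D y -> ~ U y -> exists u, D u /\ boundary M U u.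
Proof.
  intros HD Dx Ux Dy Uy. apply NNPP. intros Hno.
  assert (E : asb (U x) = asb (U y)).
  { apply (HD (fun z => asb (U z))); auto. intros z Hz.
    destruct (classic (interior M U z)) as [Hi | Hi].
    - destruct Hi as [r [Hr Hr']]. exists r. split; auto.
      intros w _ Hw. apply asb_iff. split; intros _; auto.
      apply Hr'. now rewrite dist_self.
    - assert (Hc : ~ closure M U z) by (intros Hc; apply Hno; exists z; split; auto; now split).
      apply not_all_ex_not in Hc. destruct Hc as [r Hc].
      apply imply_to_and in Hc. destruct Hc as [Hr Hc].
      exists r. split; auto. intros w _ Hw. apply asb_iff.
      split; intros H; exfalso; apply Hc; [exists w | exists z]; split; auto.
      now rewrite dist_self. }
  apply Uy, asb_true. rewrite <- E. now apply asb_true.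
Qed.

(** * Complementary domains *)

Definition loc_connected (M : MetricSpace) : Prop :=
  forall (x : M) r, 0 < r -> exists O : M -> Prop,
    is_open M O /\ conn O /\ O x /\ forall y, O y -> dist x y < r.

Lemma conn_union {M : MetricSpace} (A B : M -> Prop) x :
  conn A -> conn B -> A x -> B x -> conn (fun y => A y \/ B y).
Proof.
  intros HA HB Ax Bx phi Hphi.
  assert (E : forall y, A y \/ B y -> phi y = phi x).
  { intros y [Hy | Hy]; [apply HA | apply HB]; auto;
      (eapply locconst_sub; [| exact Hphi]; simpl; auto). }
  intros y z Hy Hz. rewrite (E y), (E z); auto.
Qed.

(** The union of all connected subsets of [A] through [x] is connected and maximal. *)
Lemma component_through {M : MetricSpace} (A : M -> Prop) x :
  A x -> exists C, component M A C /\ C x.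
Proof.
  intros Hx. set (C := fun y => exists D, conn D /\ subset M D A /\ D x /\ D y).
  assert (Cx : C x).
  { exists (fun z => z = x). repeat split; auto.
    - intros phi _ y z -> ->. auto.
    - now intros y ->. }
  exists C. split; auto. repeat split.
  - now exists x.
  - intros y (D & _ & HD & _ & Dy). auto.
  - apply connected_conn. intros phi Hphi.
    assert (E : forall y, C y -> phi y = phi x).
    { intros y (D & HD & DA & Dx & Dy). apply HD; auto.
      apply locconst_sub with C; auto. intros z Dz. exists D. auto. }
    intros y z Hy Hz. rewrite (E y), (E z); auto.
  - intros D HD CD DA y Dy. exists D. apply connected_conn in HD. auto.
Qed.

Lemma domain_conn {M : MetricSpace} (X U : M -> Prop) :
  complementary_domain M X U -> conn U.
Proof. intros (_ & _ & H & _). now apply connected_conn. Qed.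

Lemma domain_out {M : MetricSpace} (X U : M -> Prop) x :
  complementary_domain M X U -> U x -> ~ X x.
Proof. intros (_ & H & _) Ux. now apply H. Qed.

Lemma domain_max {M : MetricSpace} (X U D : M -> Prop) x :
  complementary_domain M X U -> conn D -> (forall y, D y -> ~ X y) ->
  D x -> U x -> forall y, D y -> U y.
Proof.
  intros HU HD DX Dx Ux y Dy. destruct (HU) as (_ & HX & HC & Hmax).
  apply (Hmax (fun z => U z \/ D z)); auto.
  - apply connected_conn. apply conn_union with x; auto. now apply connected_conn.
  - intros z; auto.
  - intros z [Hz | Hz]; auto.
Qed.

Lemma domain_unique {M : MetricSpace} (X U V : M -> Prop) x :
  complementary_domain M X U -> complementary_domain M X V -> U x -> V x ->
  forall y, U y -> V y.
Proof.
  intros HU HV Ux Vx. apply domain_max with X x; auto.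
  - now apply domain_conn with X.
  - intros y. now apply domain_out.
Qed.

Lemma outside_nbhd {M : MetricSpace} (X : M -> Prop) x :
  loc_connected M -> is_open M (fun y => ~ X y) -> ~ X x ->
  exists O, is_open M O /\ conn O /\ O x /\ forall y, O y -> ~ X y.
Proof.
  intros HL HX Hx. destruct (HX x Hx) as [r [Hr Hr']].
  destruct (HL x r Hr) as (O & H1 & H2 & H3 & H4). exists O. auto 6.
Qed.

Lemma domain_open {M : MetricSpace} (X U : M -> Prop) :
  loc_connected M -> is_open M (fun y => ~ X y) -> complementary_domain M X U ->
  is_open M U.
Proof.
  intros HL HX HU x Ux.
  destruct (outside_nbhd X x HL HX (domain_out X U x HU Ux)) as (O & H1 & H2 & H3 & H4).
  destruct (H1 x H3) as [r [Hr Hr']]. exists r. split; auto.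
  intros y Hy. apply domain_max with X O x; auto.
Qed.

(** A point off [X] has a connected neighbourhood off [X]; if that meets [U] it lies in [U], which
    makes the point interior. *)
Lemma domain_boundary {M : MetricSpace} (X U : M -> Prop) u :
  loc_connected M -> is_open M (fun y => ~ X y) -> complementary_domain M X U ->
  boundary M U u -> X u.
Proof.
  intros HL HX HU [Hc Hi]. apply NNPP. intros Hu.
  destruct (outside_nbhd X u HL HX Hu) as (O & H1 & H2 & H3 & H4).
  destruct (H1 u H3) as [r [Hr Hr']]. apply Hi. exists r. split; auto.
  destruct (Hc r Hr) as [z [Uz Hz]].
  intros y Hy. apply domain_max with X O z; auto.
Qed.

(** * Compactness and quasi-components *)

Lemma compact_closed {M : MetricSpace} (K : M -> Prop) :
  compact M K -> is_open M (fun x => ~ K x).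
Proof.
  intros HK x Hx.
  (* The exteriors of the balls about [x] of positive radius cover [K]; the smallest radius of a
     finite subcover gives a ball about [x] that misses [K]. *)
  destruct (HK R (fun r y => 0 < r /\ r < dist x y)) as [l Hl].
  - intros r y [Hr Hy]. exists (dist x y - r). split; [lra |].
    intros z Hz. split; auto. pose proof (dist_tri M x z y).
    rewrite (dist_sym M z y) in H. lra.
  - intros y Hy. exists (dist x y / 2).
    assert (0 < dist x y) by (apply dist_gt0; intros ->; contradiction). lra.
  - destruct (list_radius l (fun a r => 0 < a -> r <= a)) as [r [Hr Hr']].
    + intros a r r' H H' Ha. specialize (H Ha). lra.
    + intros a _. destruct (Rlt_dec 0 a).
      * exists a. split; auto. intros; lra.
      * exists 1. split; [lra |]. intros; lra.
    + exists r. split; auto. intros y Hy Ky.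
      destruct (Hl y Ky) as (a & Ha & H0 & H1). specialize (Hr' a Ha H0). lra.
Qed.

Lemma compact_sub {M : MetricSpace} (K F : M -> Prop) :
  compact M K -> is_open M (fun x => ~ F x) -> (forall x, F x -> K x) -> compact M F.
Proof.
  intros HK HF FK I O HO Hc.
  destruct (HK (option I) (fun i x => match i with Some j => O j x | None => ~ F x end))
    as [l Hl].
  - intros [i |]; auto.
  - intros x Hx. destruct (classic (F x)) as [Fx | Fx].
    + destruct (Hc x Fx) as [i Hi]. now exists (Some i).
    + now exists None.
  - exists (flat_map (fun o => match o with Some i => [i] | None => [] end) l).
    intros x Fx. destruct (Hl x (FK x Fx)) as ([i |] & Hi & Hx); [| contradiction].
    exists i. split; auto. apply in_flat_map. exists (Some i). simpl. auto.
Qed.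

(* For [x] in [F] this is the quasi-component of [x] in [F]; for [x] outside [F] it is [{x}]. *)
Definition insep {M : MetricSpace} (F : M -> Prop) (x y : M) : Prop :=
  forall phi, locconst F phi -> phi y = phi x.

Lemma insep_refl {M : MetricSpace} (F : M -> Prop) x : insep F x x.
Proof. intros phi _. auto. Qed.

Lemma insep_sub {M : MetricSpace} (F : M -> Prop) x y : F x -> insep F x y -> F y.
Proof.
  intros Fx H. apply NNPP. intros Fy.
  pose proof (H _ (locconst_outside F y Fy)) as E. cbv beta in E.
  rewrite (proj2 (asb_true (y = y))) in E; auto. symmetry in E.
  rewrite asb_true in E. subst. contradiction.
Qed.

Lemma insep_outside {M : MetricSpace} (F : M -> Prop) x y : ~ F x -> insep F x y -> y = x.
Proof.
  intros Fx H. pose proof (H _ (locconst_outside F x Fx)) as E. cbv beta in E.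
  rewrite (proj2 (asb_true (x = x))) in E; auto. now rewrite asb_true in E.
Qed.

Lemma insep_closed {M : MetricSpace} (F : M -> Prop) x :
  is_open M (fun y => ~ F y) -> is_open M (fun y => ~ insep F x y).
Proof.
  intros HF z Hz. destruct (classic (F x)) as [Fx | Fx].
  - destruct (classic (F z)) as [Fz | Fz].
    + apply not_all_ex_not in Hz. destruct Hz as [phi Hz].
      apply imply_to_and in Hz. destruct Hz as [Hphi Hz].
      destruct (Hphi z Fz) as [r [Hr Hr']]. exists r. split; auto.
      intros y Hy H. apply Hz. rewrite <- (H phi Hphi). symmetry. apply Hr'; auto.
      now apply insep_sub with x.
    + destruct (HF z Fz) as [r [Hr Hr']]. exists r. split; auto.
      intros y Hy H. apply (Hr' y Hy). now apply insep_sub with x.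
  - exists (dist z x). split.
    + apply dist_gt0. intros ->. apply Hz, insep_refl.
    + intros y Hy H. apply insep_outside in H; auto. subst. lra.
Qed.

(** A separation of the quasi-component extends, by compactness of [F], to a clopen subset of [F]
    that separates two of its points, which is impossible. *)
Lemma insep_conn {M : MetricSpace} (F : M -> Prop) x : compact M F -> conn (insep F x).
Proof.
  intros HF. destruct (classic (F x)) as [Fx | Fx].
  2: { intros phi _ y z Hy Hz. apply insep_outside in Hy, Hz; auto. congruence. }
  intros psi Hpsi.
  enough (E : forall y, insep F x y -> psi y = psi x).
  { intros y z Hy Hz. rewrite (E y), (E z); auto. }
  intros y Hy. apply NNPP. intros Hne.
  (* The halved radius makes [O true] and [O false] disjoint on all of [M], not only on the
     quasi-component. *)
  set (O := fun b z => exists a r, insep F x a /\ psi a = b /\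
      (forall w, insep F x w -> dist a w < r -> psi w = psi a) /\ dist a z < r / 2).
  assert (HO : forall b, is_open M (O b)).
  { intros b z (a & r & Ha & Hb & Hr & Hz).
    destruct (ball_open a (r / 2) z Hz) as [s [Hs Hs']].
    exists s. split; auto. intros w Hw. exists a, r. auto. }
  assert (HA : forall z, insep F x z -> O (psi z) z).
  { intros z Hz. destruct (Hpsi z Hz) as [r [Hr Hr']].
    exists z, r. rewrite dist_self. repeat split; auto; lra. }
  assert (Hdisj : forall b b' z, O b z -> O b' z -> b = b').
  { intros b b' z (a & r & Ha & Hb & Hr & Hz) (a' & r' & Ha' & Hb' & Hr' & Hz').
    pose proof (dist_tri M a z a'). rewrite (dist_sym M z a') in H.
    destruct (Rle_dec r r').
    - assert (psi a = psi a'); [| congruence]. apply Hr'; auto. rewrite dist_sym. lra.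
    - assert (psi a' = psi a); [| congruence]. apply Hr; auto. lra. }
  (* [None] stands for the thickened quasi-component, [Some phi] for the points of [F] that [phi]
     separates from [x], fattened to an open set of [M]. *)
  destruct (HF (option (M -> bool)) (fun i z => match i with
      | None => exists b, O b z
      | Some phi => locconst F phi /\ exists w r, F w /\ phi w <> phi x /\
          (forall v, F v -> dist w v < r -> phi v = phi w) /\ dist w z < r
      end)) as [l Hl].
  - intros [phi |].
    + intros z (Hphi & w & r & Fw & Hw & Hr & Hz).
      destruct (ball_open w r z Hz) as [s [Hs Hs']].
      exists s. split; auto. intros v Hv. split; auto. exists w, r. auto.
    + intros z [b Hz]. destruct (HO b z Hz) as [s [Hs Hs']]. exists s. eauto.
  - intros z Fz. destruct (classic (insep F x z)) as [Hz | Hz].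
    + exists None. exists (psi z). auto.
    + apply not_all_ex_not in Hz. destruct Hz as [phi Hz].
      apply imply_to_and in Hz. destruct Hz as [Hphi Hz].
      exists (Some phi). split; auto. destruct (Hphi z Fz) as [r [Hr Hr']].
      exists z, r. rewrite dist_self. auto.
  - set (Phi := fun z => forall phi, In (Some phi) l -> locconst F phi -> phi z = phi x).
    assert (HPhi : forall z, F z -> Phi z -> exists b, O b z).
    { intros z Fz Pz. destruct (Hl z Fz) as ([phi |] & Hi & Hz); auto. exfalso.
      destruct Hz as (Hphi & w & r & Fw & Hw & Hr & Hz).
      apply Hw. rewrite <- (Hr z Fz Hz). auto. }
    assert (Hloc : forall z, F z -> exists r, 0 < r /\
              forall w, F w -> dist z w < r -> (Phi w <-> Phi z)).
    { intros z Fz.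
      destruct (list_radius l (fun o r => forall phi, o = Some phi -> locconst F phi ->
          forall w, F w -> dist z w < r -> phi w = phi z)) as [r [Hr Hr']].
      - intros a r r' H Hr phi E Hphi w Fw Hw. apply H; auto. lra.
      - intros o _. destruct o as [phi |].
        + destruct (classic (locconst F phi)) as [Hphi | Hphi].
          * destruct (Hphi z Fz) as [r [Hr Hr']]. exists r. split; auto.
            intros phi' E. injection E as <-. auto.
          * exists 1. split; [lra |]. intros phi' E. injection E as <-. contradiction.
        + exists 1. split; [lra |]. discriminate.
      - exists r. split; auto. intros w Fw Hw. split; intros H phi Hi Hphi.
        + rewrite <- (Hr' _ Hi phi eq_refl Hphi w Fw Hw). auto.
        + rewrite (Hr' _ Hi phi eq_refl Hphi w Fw Hw). auto. }
    (* In [F], [Phi] is a clopen neighbourhood of the quasi-component covered by the two sets [O b].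
       Its part in [O (psi x)] is therefore clopen and, containing [x], contains [y]. *)
    assert (HT : locconst F (fun z => asb (Phi z /\ O (psi x) z))).
    { intros z Fz. destruct (Hloc z Fz) as [r [Hr Hr']].
      destruct (classic (Phi z)) as [Pz | Pz].
      - destruct (HPhi z Fz Pz) as [b Hb]. destruct (HO b z Hb) as [s [Hs Hs']].
        exists (Rmin r s). split; [now apply Rmin_glb_lt |].
        intros w Fw Hw. pose proof (Rmin_l r s). pose proof (Rmin_r r s).
        apply asb_iff. split; intros [H1 H2]; split; auto.
        + rewrite (Hdisj _ b w H2); auto. apply Hs'. lra.
        + apply Hr'; auto; lra.
        + rewrite (Hdisj _ b z H2); auto. apply Hs'. lra.
      - exists r. split; auto. intros w Fw Hw. apply asb_iff.
        split; intros [H1 H2]; exfalso; apply Pz; auto. apply (Hr' w); auto. }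
    pose proof (Hy _ HT) as E. simpl in E.
    rewrite (proj2 (asb_true (Phi x /\ O (psi x) x))) in E.
    + rewrite asb_true in E. destruct E as [_ E]. apply Hne.
      exact (Hdisj _ _ y (HA y Hy) E).
    + split; [intros phi _ _; auto | apply HA, insep_refl].
Qed.

(** * Indecomposable continua *)

Lemma conn_closure {M : MetricSpace} (A B : M -> Prop) :
  conn A -> (forall x, A x -> B x) -> (forall x, B x -> closure M A x) -> conn B.
Proof.
  intros HA AB BA phi Hphi x y Bx By.
  assert (E : forall z, B z -> exists w, A w /\ phi w = phi z).
  { intros z Bz. destruct (Hphi z Bz) as [r [Hr Hr']].
    destruct (BA z Bz r Hr) as [w [Aw Hw]]. exists w. auto. }
  destruct (E x Bx) as [x' [Ax' <-]], (E y By) as [y' [Ay' <-]].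
  apply HA; auto. now apply locconst_sub with B.
Qed.

(** A locally constant [psi] extends to [X] by giving the discarded side of the separation the
    constant value of [psi] on [K]; connectedness of [X] then makes it constant. *)
Lemma conn_union_clopen {M : MetricSpace} (X K : M -> Prop) phi :
  conn X -> conn K -> is_open M (fun x => ~ K x) -> (forall x, K x -> X x) ->
  (exists x, K x) -> locconst (fun x => X x /\ ~ K x) phi ->
  conn (fun x => K x \/ (X x /\ phi x = true)).
Proof.
  intros HX HK Kcl KX [k Kk] Hphi psi Hpsi.
  assert (Kc : forall x, K x -> psi x = psi k).
  { intros x Kx. apply HK; auto. eapply locconst_sub; [| exact Hpsi]. simpl; auto. }
  set (chi := fun x => if asb (K x \/ (X x /\ phi x = true)) then psi x else psi k).
  assert (Hchi : locconst X chi).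
  { intros x Xx. destruct (classic (K x)) as [Kx | Kx].
    - destruct (Hpsi x (or_introl Kx)) as [r [Hr Hr']]. exists r. split; auto.
      intros y Xy Hy. unfold chi. rewrite (proj2 (asb_true (K x \/ _)));auto.
      destruct (asb (K y \/ _)) eqn:E; [rewrite asb_true in E; auto |].
      rewrite (Kc x Kx). reflexivity.
    - destruct (Kcl x Kx) as [s [Hs Hs']].
      destruct (Hphi x (conj Xx Kx)) as [r [Hr Hr']].
      destruct (bool_dec (phi x) true) as [E | E].
      + destruct (Hpsi x) as [t [Ht Ht']]; auto.
        exists (Rmin t (Rmin r s)).
        pose proof (Rmin_l t (Rmin r s)). pose proof (Rmin_r t (Rmin r s)).
        pose proof (Rmin_l r s). pose proof (Rmin_r r s).
        split; [repeat apply Rmin_glb_lt; auto |].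
        intros y Xy Hy. assert (~ K y) by (apply Hs'; lra).
        assert (phi y = true) by (rewrite Hr'; auto; lra).
        unfold chi. rewrite (proj2 (asb_true (K x \/ _))); auto.
        rewrite (proj2 (asb_true (K y \/ _))); auto. apply Ht'; auto. lra.
      + exists (Rmin r s). pose proof (Rmin_l r s). pose proof (Rmin_r r s).
        split; [repeat apply Rmin_glb_lt; auto |].
        intros y Xy Hy. assert (~ K y) by (apply Hs'; lra).
        assert (phi y = phi x) by (apply Hr'; auto; lra).
        unfold chi. rewrite (proj2 (asb_false (K x \/ _))) by tauto.
        rewrite (proj2 (asb_false (K y \/ _))); auto. intros [? | [_ ?]]; congruence. }
  assert (E : forall x, K x \/ (X x /\ phi x = true) -> psi x = chi x).
  { intros x Hx. unfold chi. now rewrite (proj2 (asb_true _) Hx). }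
  intros x y Hx Hy. rewrite E, (E y); auto. apply HX; auto.
  - destruct Hx as [? | []]; auto.
  - destruct Hy as [? | []]; auto.
Qed.

(** If [K] contained a relatively open piece of [X], then [X] would decompose: into [K] and the
    closure of [X \ K] when that difference is connected, and otherwise into the unions of [K] with
    the two sides of a separation of [X \ K]. *)
Lemma indecomposable_nowhere_dense {M : MetricSpace} (X K : M -> Prop) :
  indecomposable M X -> conn K -> is_open M (fun x => ~ K x) ->
  (forall x, K x -> X x) -> (exists x, K x) -> (exists x, X x /\ ~ K x) ->
  forall G, is_open M G -> (exists x, X x /\ G x) -> exists x, X x /\ G x /\ ~ K x.
Proof.
  intros [(HXn & HXc & HX) Hind] HK Kcl KX Kn [p [Xp Kp]] G HG [q [Xq Gq]].
  apply connected_conn in HX.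
  apply NNPP. intros Hno. apply Hind.
  assert (GK : forall x, X x -> G x -> K x).
  { intros x Xx Gx. apply NNPP. intros Kx. apply Hno. eauto. }
  assert (Xcl := compact_closed X HXc).
  destruct (classic (conn (fun x => X x /\ ~ K x))) as [Hc | Hc].
  - set (B := fun x => X x /\ closure M (fun x => X x /\ ~ K x) x).
    assert (HB : forall x, X x /\ ~ K x -> B x).
    { intros x Hx. split; [tauto |]. intros r Hr. exists x. now rewrite dist_self. }
    assert (Bcl : is_open M (fun x => ~ B x)).
    { intros x Hx. destruct (classic (X x)) as [Xx | Xx].
      - assert (Hx' : ~ closure M (fun x => X x /\ ~ K x) x) by (intros ?; apply Hx; now split).
        apply not_all_ex_not in Hx'. destruct Hx' as [r Hx'].
        apply imply_to_and in Hx'. destruct Hx' as [Hr Hx'].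
        exists (r / 2). split; [lra |]. intros y Hy [_ H].
        destruct (H (r / 2)) as [z [Hz Hd]]; [lra |].
        apply Hx'. exists z. split; auto. pose proof (dist_tri M x y z). lra.
      - destruct (Xcl x Xx) as [r [Hr Hr']]. exists r. split; auto.
        intros y Hy [Xy _]. now apply (Hr' y). }
    exists K, B. repeat split; auto.
    + now apply compact_sub with X.
    + now apply connected_conn.
    + exists p. auto.
    + apply compact_sub with X; auto. now intros x [].
    + apply connected_conn. eapply conn_closure; eauto. now intros x [].
    + now intros x [].
    + now exists p.
    + exists q. split; auto. intros [_ H].
      destruct (HG q Gq) as [r [Hr Hr']]. destruct (H r Hr) as [y [[Xy Ky] Hy]]. auto.
    + intros Xx. destruct (classic (K x)); auto.
    + intros [? | []]; auto.
  - apply not_all_ex_not in Hc. destruct Hc as [phi Hc].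
    apply imply_to_and in Hc. destruct Hc as [Hphi Hc].
    assert (Hphi' : locconst (fun x => X x /\ ~ K x) (fun x => negb (phi x))).
    { intros x Hx. destruct (Hphi x Hx) as [r [Hr Hr']]. exists r. split; auto.
      intros y Hy Hd. now rewrite (Hr' y). }
    assert (Hcont : forall f, locconst (fun x => X x /\ ~ K x) f ->
              continuum M (fun x => K x \/ (X x /\ f x = true))).
    { intros f Hf. repeat split.
      - destruct Kn as [k Kk]. exists k. auto.
      - apply compact_sub with X; auto; [| intros x [? | []]; auto].
        intros x Hx. destruct (classic (X x)) as [Xx | Xx].
        + assert (Kx : ~ K x) by tauto. destruct (Kcl x Kx) as [s [Hs Hs']].
          destruct (Hf x (conj Xx Kx)) as [r [Hr Hr']].
          exists (Rmin r s). pose proof (Rmin_l r s). pose proof (Rmin_r r s).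
          split; [now apply Rmin_glb_lt |]. intros y Hy [Ky | [Xy Hy']].
          * apply (Hs' y); auto. lra.
          * apply Hx. right. split; auto. rewrite <- (Hr' y); auto; [| lra].
            split; auto. apply Hs'. lra.
        + destruct (Xcl x Xx) as [r [Hr Hr']]. exists r. split; auto.
          intros y Hy [Ky | [Xy _]]; apply (Hr' y); auto.
      - apply connected_conn. apply conn_union_clopen; auto. }
    apply not_all_ex_not in Hc. destruct Hc as [a Hc].
    apply not_all_ex_not in Hc. destruct Hc as [b Hc].
    apply imply_to_and in Hc. destruct Hc as [[Xa Ka] Hc].
    apply imply_to_and in Hc. destruct Hc as [[Xb Kb] Hc].
    assert (Hex : forall v, exists x, X x /\ ~ K x /\ phi x = v).
    { intros v. destruct (bool_dec (phi a) v); [exists a | exists b]; repeat split; auto.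
      destruct (phi a), (phi b), v; congruence. }
    destruct (Hex true) as (a1 & ? & ? & E1), (Hex false) as (b1 & ? & ? & E2).
    exists (fun x => K x \/ (X x /\ phi x = true)), (fun x => K x \/ (X x /\ negb (phi x) = true)).
    repeat match goal with |- _ /\ _ => split end.
    + now apply (Hcont phi).
    + now apply (Hcont (fun x => negb (phi x))).
    + intros x [? | []]; auto.
    + intros x [? | []]; auto.
    + exists b1. split; auto. intros [? | []]; congruence.
    + exists a1. split; auto. rewrite E1. intros [? | []]; simpl in *; congruence.
    + intros x. split.
      * intros Xx. destruct (phi x); auto.
      * intros [[? | []] | [? | []]]; auto.
Qed.

(** Finite form of the Baire argument: [G] is replaced by [G \ K], which is open and still meets
    [X]. *)
Lemma avoid_nowhere_dense {M : MetricSpace} (X : M -> Prop) (l : list (M -> Prop)) :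
  (forall K, In K l -> is_open M (fun x => ~ K x) /\
     forall G, is_open M G -> (exists x, X x /\ G x) -> exists x, X x /\ G x /\ ~ K x) ->
  forall G, is_open M G -> (exists x, X x /\ G x) ->
  exists x, X x /\ G x /\ forall K, In K l -> ~ K x.
Proof.
  induction l as [|K l IH]; intros Hl G HG Hn.
  - destruct Hn as [x [Xx Gx]]. exists x. repeat split; auto.
  - destruct (Hl K (or_introl eq_refl)) as [Kcl HK].
    destruct (HK G HG Hn) as (x & Xx & Gx & Kx).
    destruct (IH (fun K' h => Hl K' (or_intror h)) (fun x => G x /\ ~ K x)) as (y & Xy & [Gy Ky] & Hy).
    + intros y [Gy Ky]. destruct (HG y Gy) as [r [Hr Hr']], (Kcl y Ky) as [s [Hs Hs']].
      exists (Rmin r s). pose proof (Rmin_l r s). pose proof (Rmin_r r s).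
      split; [now apply Rmin_glb_lt |]. intros z Hz.
      split; [apply Hr' | apply Hs']; lra.
    + exists x. auto.
    + exists y. repeat split; auto. intros K' [<- | H]; auto.
Qed.

(** Points are chosen one at a time, each off the quasi-components of the earlier ones in every
    [X \ B]; these are proper subcontinua, hence nowhere dense. For each [B], [H x] acts as the
    indicator of [x] among the chosen points. *)
Lemma separated_points {M : MetricSpace} (X : M -> Prop) (Bs : list (M -> Prop)) (n : nat) :
  indecomposable M X -> (exists x y, X x /\ X y /\ x <> y) ->
  (forall B, In B Bs -> is_open M B /\ exists x, X x /\ B x) ->
  forall G, is_open M G -> (exists x, X x /\ G x) ->
  exists l : list M, length l = n /\ NoDup l /\ (forall x, In x l -> X x /\ G x) /\
    forall B, In B Bs -> exists H : M -> M -> bool, forall x, In x l ->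
      locconst (fun z => X z /\ ~ B z) (H x) /\
      forall y, In y l -> H x y = asb (y = x).
Proof.
  intros Hind (p & q & Xp & Xq & Hpq) HBs G HG Hn.
  destruct (Hind) as [(_ & HXc & _) _].
  assert (Xcl := compact_closed X HXc).
  assert (Hnd : forall B x, is_open M B -> (exists z, X z /\ B z) -> X x ->
    is_open M (fun y => ~ insep (fun z => X z /\ ~ B z) x y) /\
    forall G, is_open M G -> (exists y, X y /\ G y) ->
      exists y, X y /\ G y /\ ~ insep (fun z => X z /\ ~ B z) x y).
  { intros B x HB [b [Xb Bb]] Xx.
    assert (Fcl : is_open M (fun z => ~ (X z /\ ~ B z))).
    { intros z Hz. destruct (classic (X z)) as [Xz | Xz].
      - assert (Bz : B z) by tauto. destruct (HB z Bz) as [r [Hr Hr']].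
        exists r. split; auto. intros y Hy []. auto.
      - destruct (Xcl z Xz) as [r [Hr Hr']]. exists r. split; auto.
        intros y Hy []. now apply (Hr' y). }
    assert (Icl := insep_closed _ x Fcl). split; auto.
    apply indecomposable_nowhere_dense; auto.
    - apply insep_conn. apply compact_sub with X; auto. tauto.
    - intros y Hy. destruct (classic (X x /\ ~ B x)) as [Fx | Fx].
      + now apply insep_sub in Hy.
      + apply insep_outside in Hy; auto. now subst.
    - exists x. apply insep_refl.
    (* Properness: a quasi-component in [X \ B] misses [b]; when [x] is in [B] it is [{x}], and [X]
       has two points. *)
    - destruct (classic (X x /\ ~ B x)) as [Fx | Fx].
      + exists b. split; auto. intros H. apply insep_sub in H; auto. tauto.
      + destruct (classic (p = x)) as [-> | E].
        * exists q. split; auto. intros H. apply insep_outside in H; auto.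
        * exists p. split; auto. intros H. apply insep_outside in H; auto. }
  (* With [B0] the whole space, [X \ B0] is empty and its quasi-components are single points;
     avoiding them makes the new point distinct from the old ones. *)
  set (B0 := fun _ : M => True).
  assert (HB0 : is_open M B0) by (intros x _; exists 1; split; [lra | intros; exact I]).
  induction n as [|n IH].
  - exists []. repeat split; try constructor; try contradiction.
    intros B _. exists (fun _ _ => true). intros x [].
  - destruct IH as (l & Hlen & Hnodup & HlX & Hsep).
    destruct (avoid_nowhere_dense X (flat_map (fun B =>
        map (fun x => insep (fun z => X z /\ ~ B z) x) l) (B0 :: Bs))) with (G := G)
      as (x & Xx & Gx & Hx); auto.
    { intros K HK. apply in_flat_map in HK. destruct HK as (B & HB & HK).
      apply in_map_iff in HK. destruct HK as (x & <- & Hx).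
      destruct HB as [<- | HB].
      - apply Hnd; auto; [| now apply HlX]. exists p. split; auto. exact I.
      - destruct (HBs B HB). apply Hnd; auto. now apply HlX. }
    assert (Hx' : forall B y, In B (B0 :: Bs) -> In y l ->
                    ~ insep (fun z => X z /\ ~ B z) y x).
    { intros B y HB Hy. apply Hx. apply in_flat_map. exists B. split; auto.
      apply in_map_iff. exists y. auto. }
    assert (Hxl : ~ In x l).
    { intros Hi. apply (Hx' B0 x); auto; [now left | apply insep_refl]. }
    exists (x :: l). repeat split.
    + simpl. now rewrite Hlen.
    + now constructor.
    + destruct H as [<- | H]; auto. now apply HlX.
    + destruct H as [<- | H]; auto. now apply HlX.
    + intros B HB. destruct (Hsep B HB) as [H HH].
      set (F := fun z => X z /\ ~ B z) in *.
      assert (Hpair : forall y, exists phi, In y l -> locconst F phi /\ phi y = false /\ phi x = true).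
      { intros y. destruct (classic (In y l)) as [Hy |]; [| exists (fun _ => true); tauto].
        assert (Hs := Hx' B y (or_intror HB) Hy).
        apply not_all_ex_not in Hs. destruct Hs as [phi Hs].
        apply imply_to_and in Hs. destruct Hs as [Hphi Hs].
        exists (fun z => xorb (phi z) (phi y)). intros _. repeat split.
        - apply (locconst_op xorb); auto. intros z _. exists 1. split; [lra | auto].
        - apply xorb_nilpotent.
        - destruct (phi x), (phi y); auto; congruence. }
      destruct (choice _ Hpair) as [P HP].
      (* The product of the [P y] is the indicator of the new point; multiplying an old [H a] by
         [1 + P a] kills its value at [x] and keeps those at the old points. *)
      set (h := fun z => forallb (fun y => P y z) l).
      assert (Hhloc : forall l', (forall y, In y l' -> In y l) ->
                locconst F (fun z => forallb (fun y => P y z) l')).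
      { induction l' as [|y l' IHl]; intros Hsub; simpl.
        - intros z _. exists 1. split; [lra | auto].
        - apply (locconst_op andb); [apply HP; apply Hsub; now left |].
          apply IHl. intros; apply Hsub. now right. }
      assert (hx : h x = true) by (apply forallb_forall; intros y Hy; now apply HP).
      assert (hy : forall y, In y l -> h y = false).
      { intros y Hy. destruct (h y) eqn:E; auto. unfold h in E.
        rewrite forallb_forall in E. rewrite <- (E y Hy). apply (HP y Hy). }
      exists (fun a z => if asb (a = x) then h z else andb (H a z) (negb (P a z))).
      intros a Ha. destruct (classic (a = x)) as [-> | E].
      * rewrite (proj2 (asb_true (x = x))); auto. split; [now apply Hhloc |].
        intros y [<- | Hy].
        -- rewrite hx. symmetry. now apply asb_true.
        -- rewrite hy; auto. symmetry. apply asb_false. intros ->. contradiction.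
      * rewrite (proj2 (asb_false (a = x))); auto.
        destruct Ha as [-> | Ha]; [contradiction |]. destruct (HH a Ha) as [H1 H2].
        destruct (HP a Ha) as (P1 & P2 & P3). split.
        -- apply (locconst_op (fun u v => andb u (negb v))); auto.
        -- intros y [<- | Hy].
           ++ rewrite P3, andb_false_r. symmetry. apply asb_false. congruence.
           ++ rewrite H2; auto. destruct (classic (y = a)) as [-> | Ey].
              ** now rewrite P2, andb_true_r.
              ** now rewrite (proj2 (asb_false (y = a))).
Qed.

(** * Primitives of two-valued cocycles *)

Definition frontier {M : MetricSpace} (W : M -> bool) (x : M) : Prop :=
  W x = false /\ forall r, 0 < r -> exists y, dist x y < r /\ W y = true.

(* [(W, h)], with [h] locally constant on the frontier of the open set [W], is a Cech
   1-cocycle with values in Z/2: it encodes the double cover obtained from two copies of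
   the complement of [W] and two copies of [W], glued at a frontier point [x] with a swap
   iff [h x = true]. A primitive on [D] is a trivialisation of this cover over [D]. *)
Definition primitive {M : MetricSpace} (W h : M -> bool) (D : M -> Prop) (c : M -> bool) :=
  forall x, D x -> exists r, 0 < r /\ forall y, D y -> dist x y < r ->
    c y = xorb (c x) (negb (W x) && W y && h x).

Definition open_pred {M : MetricSpace} (W : M -> bool) := is_open M (fun x => W x = true).

Lemma primitive_sub {M : MetricSpace} (W h : M -> bool) (A B : M -> Prop) c :
  (forall x, A x -> B x) -> primitive W h B c -> primitive W h A c.
Proof.
  intros H HB x Hx. destruct (HB x (H x Hx)) as [r [Hr Hr']]. exists r. auto.
Qed.

Lemma primitive_flip {M : MetricSpace} (W h : M -> bool) (D : M -> Prop) c b :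
  primitive W h D c -> primitive W h D (fun x => xorb b (c x)).
Proof.
  intros H x Hx. destruct (H x Hx) as [r [Hr Hr']]. exists r. split; auto.
  intros y Hy Hd. rewrite (Hr' y Hy Hd). now rewrite xorb_assoc.
Qed.

Lemma primitive_diff {M : MetricSpace} (W h : M -> bool) (A B : M -> Prop) c d :
  primitive W h A c -> primitive W h B d ->
  locconst (fun x => A x /\ B x) (fun x => xorb (c x) (d x)).
Proof.
  intros H1 H2 x [Ax Bx].
  destruct (H1 x Ax) as [r [Hr Hr']], (H2 x Bx) as [s [Hs Hs']].
  exists (Rmin r s). split; [now apply Rmin_glb_lt |].
  intros y [Ay By] Hd. pose proof (Rmin_l r s). pose proof (Rmin_r r s).
  rewrite (Hr' y), (Hs' y); auto; try lra.
  destruct (c x), (d x), (negb (W x) && W y && h x); auto.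
Qed.

Lemma primitive_xor {M : MetricSpace} (W h k : M -> bool) (D : M -> Prop) c d :
  primitive W h D c -> primitive W k D d ->
  primitive W (fun x => xorb (h x) (k x)) D (fun x => xorb (c x) (d x)).
Proof.
  intros H1 H2 x Dx.
  destruct (H1 x Dx) as [r [Hr Hr']], (H2 x Dx) as [s [Hs Hs']].
  exists (Rmin r s). split; [now apply Rmin_glb_lt |].
  intros y Dy Hd. pose proof (Rmin_l r s). pose proof (Rmin_r r s).
  rewrite (Hr' y), (Hs' y); auto; try lra.
  destruct (c x), (d x), (W x), (W y), (h x), (k x); auto.
Qed.

(** A Mayer-Vietoris argument: on the connected overlap the primitives differ by a constant, so [d]
    can be flipped to agree with [c] there. The last two hypotheses say that each set is relatively
    closed in the union, so near a point outside the overlap only one set counts. *)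
Lemma primitive_glue {M : MetricSpace} (W h : M -> bool) (A B : M -> Prop) c d :
  primitive W h A c -> primitive W h B d ->
  conn (fun x => A x /\ B x) ->
  (forall x, A x -> ~ B x -> exists r, 0 < r /\ forall y, B y -> r <= dist x y) ->
  (forall x, B x -> ~ A x -> exists r, 0 < r /\ forall y, A y -> r <= dist x y) ->
  exists e, primitive W h (fun x => A x \/ B x) e.
Proof.
  intros Hc Hd HAB HA HB.
  assert (Hagree : exists d', primitive W h B d' /\ forall x, A x -> B x -> c x = d' x).
  { destruct (classic (exists x, A x /\ B x)) as [[z Hz] | Hno].
    - exists (fun x => xorb (xorb (c z) (d z)) (d x)). split; [now apply primitive_flip |].
      intros x Ax Bx.
      pose proof (HAB _ (primitive_diff W h A B c d Hc Hd) x z (conj Ax Bx) Hz) as E.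
      simpl in E. rewrite <- E. now destruct (c x), (d x).
    - exists d. split; auto. intros x Ax Bx. exfalso. eauto. }
  clear d Hd. destruct Hagree as [d [Hd Hcd]].
  exists (fun x => if asb (A x) then c x else d x).
  assert (EB : forall x, B x -> (if asb (A x) then c x else d x) = d x).
  { intros x Bx. destruct (asb (A x)) eqn:E; auto. rewrite asb_true in E. auto. }
  assert (EA : forall x, A x -> (if asb (A x) then c x else d x) = c x).
  { intros x Ax. now rewrite (proj2 (asb_true _) Ax). }
  intros x Hx. destruct (classic (A x)) as [Ax | Ax].
  - destruct (Hc x Ax) as [r [Hr Hr']]. rewrite (EA x Ax).
    destruct (classic (B x)) as [Bx | Bx].
    + destruct (Hd x Bx) as [s [Hs Hs']].
      exists (Rmin r s). split; [now apply Rmin_glb_lt |].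
      intros y Hy Hxy. pose proof (Rmin_l r s). pose proof (Rmin_r r s).
      destruct Hy as [Ay | By].
      * rewrite EA; auto. apply Hr'; auto. lra.
      * rewrite EB; auto. rewrite (Hcd x); auto. apply Hs'; auto. lra.
    + destruct (HA x Ax Bx) as [s [Hs Hs']].
      exists (Rmin r s). split; [now apply Rmin_glb_lt |].
      intros y Hy Hxy. pose proof (Rmin_l r s). pose proof (Rmin_r r s).
      destruct Hy as [Ay | By].
      * rewrite EA; auto. apply Hr'; auto. lra.
      * specialize (Hs' y By). lra.
  - destruct Hx as [? | Bx]; [contradiction |].
    destruct (Hd x Bx) as [r [Hr Hr']], (HB x Bx Ax) as [s [Hs Hs']].
    rewrite (EB x Bx). exists (Rmin r s). split; [now apply Rmin_glb_lt |].
    intros y Hy Hxy. pose proof (Rmin_l r s). pose proof (Rmin_r r s).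
    destruct Hy as [Ay | By].
    + specialize (Hs' y Ay). lra.
    + rewrite EB; auto. apply Hr'; auto. lra.
Qed.

(** Inside [W] and off its closure zero is a primitive; near a frontier point [h] has the constant
    value [h x0], and [W && h x0] is a primitive. *)
Lemma primitive_local {M : MetricSpace} (W h : M -> bool) (x0 : M) :
  open_pred W -> locconst (frontier W) h ->
  exists r, 0 < r /\ exists c, primitive W h (fun y => dist x0 y < r) c.
Proof.
  intros HW Hh.
  assert (Hout : forall x, W x = false -> ~ frontier W x ->
            exists r, 0 < r /\ forall y, dist x y < r -> W y = false).
  { intros x Wx Hx. apply NNPP. intros Hno. apply Hx. split; auto.
    intros r Hr. apply NNPP. intros Hno'. apply Hno. exists r. split; auto.
    intros y Hy. destruct (W y) eqn:E; auto. exfalso. eauto. }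
  destruct (W x0) eqn:W0; [| destruct (classic (frontier W x0)) as [B0 | B0]].
  - destruct (HW x0 W0) as [r [Hr Hr']]. exists r. split; auto.
    exists (fun _ => false). intros x Hx. exists 1. split; [lra |].
    intros y _ _. now rewrite (Hr' x Hx).
  - destruct (Hh x0 B0) as [r [Hr Hr']]. exists r. split; auto.
    exists (fun y => W y && h x0). intros x Hx. destruct (W x) eqn:Wx.
    + destruct (HW x Wx) as [s [Hs Hs']]. exists s. split; auto.
      intros y _ Hy. rewrite (Hs' y Hy). now destruct (h x0).
    + destruct (classic (frontier W x)) as [Bx | Bx].
      * exists 1. split; [lra |]. intros y _ _. now rewrite (Hr' x).
      * destruct (Hout x Wx Bx) as [s [Hs Hs']]. exists s. split; auto.
        intros y _ Hy. now rewrite (Hs' y Hy).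
  - destruct (Hout x0 W0 B0) as [r [Hr Hr']]. exists r. split; auto.
    exists (fun _ => false). intros x Hx. exists 1. split; [lra |].
    intros y Hy _. now rewrite (Hr' y Hy), andb_false_r.
Qed.

(** * Plane charts *)

(** The supremum of the endpoints reachable from [A] can be passed by a short interval around it
    unless it is [B]. This supplies the compactness of intervals for segments and rectangles in a
    chart. *)
Lemma cousin (G : R -> R -> Prop) (A B : R) :
  A <= B ->
  (forall a b c, A <= a -> a <= b -> b <= c -> c <= B -> G a b -> G b c -> G a c) ->
  (forall x, A <= x <= B -> exists d, 0 < d /\ forall a b, A <= a -> a <= x -> x <= b ->
     b <= B -> b - a < d -> G a b) ->
  G A B.
Proof.
  intros HAB Hadd Hloc.
  set (E := fun t => A <= t <= B /\ G A t).
  assert (EA : E A).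
  { split; [lra |]. destruct (Hloc A) as [d [Hd H]]; [lra |]. apply H; lra. }
  destruct (completeness E) as [s [Hub Hlub]].
  - exists B. intros t [Ht _]. lra.
  - now exists A.
  - assert (As : A <= s) by now apply Hub.
    assert (sB : s <= B) by (apply Hlub; intros t [Ht _]; lra).
    destruct (Hloc s) as [d [Hd H]]; [lra |].
    assert (Ht : exists t, E t /\ s - d / 2 < t).
    { apply NNPP. intros Hno. enough (s <= s - d / 2) by lra. apply Hlub.
      intros t Et. destruct (Rle_dec t (s - d / 2)); auto. exfalso. apply Hno.
      exists t. split; auto. lra. }
    destruct Ht as [t [[Ht Gt] Hst]]. assert (t <= s) by now apply Hub.
    (* Since [t] is within [d / 2] of [s], going at most [d / 3] beyond [s] keeps the interval
       shorter than [d]. *)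
    set (s' := Rmin (s + d / 3) B).
    assert (s' <= s + d / 3) by apply Rmin_l. assert (s' <= B) by apply Rmin_r.
    assert (s <= s') by (apply Rmin_glb; lra).
    assert (Gs : G A s').
    { apply Hadd with t; try lra; auto. apply H; lra. }
    assert (s' <= s) by (apply Hub; split; auto; lra).
    unfold s', Rmin in *. destruct (Rle_dec (s + d / 3) B); try lra. exact Gs.
Qed.

Lemma euclid_le (p q : R * R) : euclid p q <= Rabs (fst p - fst q) + Rabs (snd p - snd q).
Proof.
  unfold euclid. set (a := fst p - fst q). set (b := snd p - snd q).
  pose proof (Rabs_pos a). pose proof (Rabs_pos b).
  rewrite <- (sqrt_Rsqr (Rabs a + Rabs b)) by lra.
  apply sqrt_le_1_alt. rewrite <- (pow2_abs a), <- (pow2_abs b). unfold Rsqr. nra.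
Qed.

Lemma euclid_ge (p q : R * R) :
  Rabs (fst p - fst q) <= euclid p q /\ Rabs (snd p - snd q) <= euclid p q.
Proof.
  unfold euclid. set (a := fst p - fst q). set (b := snd p - snd q).
  split; rewrite <- sqrt_Rsqr_abs; apply sqrt_le_1_alt; unfold Rsqr; nra.
Qed.

Definition chart {M : MetricSpace} (U : M -> Prop) (f : M -> R * R) (g : R * R -> M) : Prop :=
  is_open M U /\ continuous_on_to_R2 M U f /\ continuous_from_R2 M g /\
  (forall y, U y -> g (f y) = y) /\ (forall p, U (g p) /\ f (g p) = p).

Lemma chart_coords {M : MetricSpace} (U : M -> Prop) f g x e :
  chart U f g -> U x -> 0 < e -> exists r, 0 < r /\ forall y, U y -> dist x y < r ->
    Rabs (fst (f x) - fst (f y)) < e /\ Rabs (snd (f x) - snd (f y)) < e.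
Proof.
  intros (_ & Hf & _) Ux He. destruct (Hf x Ux e He) as [r [Hr Hr']].
  exists r. split; auto. intros y Uy Hy. specialize (Hr' y Uy Hy).
  destruct (euclid_ge (f x) (f y)). lra.
Qed.

Lemma chart_square_open {M : MetricSpace} (U : M -> Prop) f g p e :
  chart U f g -> is_open M (fun y => U y /\ Rabs (fst p - fst (f y)) < e /\
                                     Rabs (snd p - snd (f y)) < e).
Proof.
  intros HC x (Ux & H1 & H2).
  destruct (chart_coords U f g x (Rmin (e - Rabs (fst p - fst (f x)))
                                       (e - Rabs (snd p - snd (f x)))) HC Ux) as [r [Hr Hr']].
  { apply Rmin_glb_lt; lra. }
  destruct (proj1 HC x Ux) as [s [Hs Hs']].
  exists (Rmin r s). split; [now apply Rmin_glb_lt |].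
  intros y Hy. pose proof (Rmin_l r s). pose proof (Rmin_r r s).
  assert (Uy : U y) by (apply Hs'; lra).
  destruct (Hr' y Uy) as [H3 H4]; [lra |].
  pose proof (Rmin_l (e - Rabs (fst p - fst (f x))) (e - Rabs (snd p - snd (f x)))).
  pose proof (Rmin_r (e - Rabs (fst p - fst (f x))) (e - Rabs (snd p - snd (f x)))).
  pose proof (Rabs_triang (fst p - fst (f x)) (fst (f x) - fst (f y))).
  pose proof (Rabs_triang (snd p - snd (f x)) (snd (f x) - snd (f y))).
  replace (fst p - fst (f x) + (fst (f x) - fst (f y))) with (fst p - fst (f y)) in * by ring.
  replace (snd p - snd (f x) + (snd (f x) - snd (f y))) with (snd p - snd (f y)) in * by ring.
  repeat split; auto; lra.
Qed.

Lemma chart_convex_conn {M : MetricSpace} (U : M -> Prop) f g (C : R * R -> Prop) :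
  chart U f g ->
  (forall p q t, C p -> C q -> 0 <= t <= 1 ->
     C (fst p + t * (fst q - fst p), snd p + t * (snd q - snd p))) ->
  conn (fun y => U y /\ C (f y)).
Proof.
  intros (_ & _ & Hg & Hgf & Hfg) HC phi Hphi x y [Ux Cx] [Uy Cy].
  set (gam := fun t => (fst (f x) + t * (fst (f y) - fst (f x)),
                        snd (f x) + t * (snd (f y) - snd (f x)))).
  assert (E : phi (g (gam 0)) = phi (g (gam 1))).
  { apply (cousin (fun a b => phi (g (gam a)) = phi (g (gam b)))); [lra | congruence |].
    intros t Ht.
    assert (HD : forall u, 0 <= u <= 1 -> U (g (gam u)) /\ C (f (g (gam u)))).
    { intros u Hu. destruct (Hfg (gam u)) as [H1 H2]. rewrite H2. split; auto. now apply HC. }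
    destruct (Hphi _ (HD t Ht)) as [r [Hr Hr']].
    destruct (Hg (gam t) r Hr) as [d [Hd Hd']].
    (* [L] bounds the speed of [gam] in the sum norm; the added 1 keeps it positive when the
       endpoints coincide. *)
    set (L := Rabs (fst (f y) - fst (f x)) + Rabs (snd (f y) - snd (f x)) + 1).
    assert (HL : 0 < L).
    { unfold L. pose proof (Rabs_pos (fst (f y) - fst (f x))).
      pose proof (Rabs_pos (snd (f y) - snd (f x))). lra. }
    assert (Hclose : forall u, 0 <= u <= 1 -> Rabs (t - u) < d / L -> phi (g (gam u)) = phi (g (gam t))).
    { intros u Hu Htu. apply Hr'; [now apply HD |]. apply Hd'.
      eapply Rle_lt_trans; [apply euclid_le |]. simpl.
      replace (fst (f x) + t * (fst (f y) - fst (f x)) - (fst (f x) + u * (fst (f y) - fst (f x))))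
        with ((t - u) * (fst (f y) - fst (f x))) by ring.
      replace (snd (f x) + t * (snd (f y) - snd (f x)) - (snd (f x) + u * (snd (f y) - snd (f x))))
        with ((t - u) * (snd (f y) - snd (f x))) by ring.
      rewrite !Rabs_mult.
      assert (Rabs (t - u) * L < d).
      { apply Rmult_lt_compat_r with (r := L) in Htu; auto.
        unfold Rdiv in Htu. rewrite Rmult_assoc, Rinv_l in Htu; lra. }
      pose proof (Rabs_pos (t - u)). unfold L in *. lra. }
    exists (d / L). split; [now apply Rdiv_lt_0_compat |].
    intros a b H1 H2 H3 H4 H5. rewrite (Hclose a), (Hclose b); auto; try lra;
      apply Rabs_def1; lra. }
  replace (gam 0) with (f x) in E.
  2:{ unfold gam. rewrite (surjective_pairing (f x)) at 1. f_equal; ring. }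
  replace (gam 1) with (f y) in E.
  2:{ unfold gam. rewrite (surjective_pairing (f y)) at 1. f_equal; ring. }
  now rewrite !Hgf in E.
Qed.

(** Degenerate sides are allowed, so the common edge of two adjacent rectangles is again a
    [rect]. *)
Definition rect {M : MetricSpace} (U : M -> Prop) (f : M -> R * R) (a b c d : R) (y : M) : Prop :=
  U y /\ (a <= fst (f y) <= b /\ c <= snd (f y) <= d).

Lemma rect_conn {M : MetricSpace} (U : M -> Prop) f g a b c d :
  chart U f g -> conn (rect U f a b c d).
Proof.
  intros H. apply (chart_convex_conn U f g (fun p => a <= fst p <= b /\ c <= snd p <= d)); auto.
  simpl. intros. nra.
Qed.

Lemma conn_ext {M : MetricSpace} (A B : M -> Prop) :
  (forall x, A x <-> B x) -> conn A -> conn B.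
Proof.
  intros H HA phi Hphi x y Bx By. apply HA; try now apply H.
  apply locconst_sub with B; auto. apply H.
Qed.

Lemma rect_glue {M : MetricSpace} (U : M -> Prop) f g (W h : M -> bool) (a m b c d : R) :
  chart U f g -> a <= m -> m <= b ->
  (exists e, primitive W h (rect U f a m c d) e) ->
  (exists e, primitive W h (rect U f m b c d) e) ->
  exists e, primitive W h (rect U f a b c d) e.
Proof.
  intros HC Ham Hmb [e1 H1] [e2 H2].
  destruct (primitive_glue W h (rect U f a m c d) (rect U f m b c d) e1 e2) as [e He]; auto.
  - apply (conn_ext (rect U f m m c d)).
    + intros x. unfold rect. split; intros; intuition lra.
    + now apply rect_conn with g.
  - intros x [Ux Hx] Hno. assert (fst (f x) < m).
    { apply Rnot_le_lt. intros Hm. apply Hno. split; auto. lra. }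
    destruct (chart_coords U f g x (m - fst (f x)) HC Ux) as [r [Hr Hr']]; [lra |].
    exists r. split; auto. intros y [Uy Hy]. apply Rnot_lt_le. intros Hd.
    destruct (Hr' y Uy Hd) as [Hf _]. apply Rabs_def2 in Hf. lra.
  - intros x [Ux Hx] Hno. assert (m < fst (f x)).
    { apply Rnot_le_lt. intros Hm. apply Hno. split; auto. lra. }
    destruct (chart_coords U f g x (fst (f x) - m) HC Ux) as [r [Hr Hr']]; [lra |].
    exists r. split; auto. intros y [Uy Hy]. apply Rnot_lt_le. intros Hd.
    destruct (Hr' y Uy Hd) as [Hf _]. apply Rabs_def2 in Hf. lra.
  - exists e. eapply primitive_sub; [| exact He]. intros x [Ux Hx]. simpl.
    destruct (Rle_dec (fst (f x)) m); [left | right]; split; auto; lra.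
Qed.

(** Lets [rect_glue] also join rectangles stacked in the second coordinate. *)
Lemma chart_swap {M : MetricSpace} (U : M -> Prop) f g :
  chart U f g -> chart U (fun y => (snd (f y), fst (f y))) (fun p => g (snd p, fst p)).
Proof.
  assert (Hsw : forall p q : R * R, euclid (snd p, fst p) (snd q, fst q) = euclid p q).
  { intros p q. unfold euclid. simpl. f_equal. ring. }
  intros (HU & Hf & Hg & Hgf & Hfg). repeat split; auto.
  - intros x Ux e He. destruct (Hf x Ux e He) as [r [Hr Hr']]. exists r. split; auto.
    intros y Uy Hy. rewrite Hsw. auto.
  - intros p e He. destruct (Hg (snd p, fst p) e He) as [r [Hr Hr']]. exists r. split; auto.
    intros q Hq. apply Hr'. now rewrite Hsw.
  - intros y Uy. simpl. now rewrite <- surjective_pairing, Hgf.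
  - apply Hfg.
  - destruct (Hfg (snd p, fst p)) as [_ E]. rewrite E. simpl. now rewrite <- surjective_pairing.
Qed.

(** H^1 of a rectangle vanishes, by interval induction in both coordinates: local primitives stack
    into one over a thin vertical strip, and strips are glued side by side. *)
Lemma rect_primitive {M : MetricSpace} (U : M -> Prop) f g (W h : M -> bool) (A B C D : R) :
  chart U f g -> open_pred W -> locconst (frontier W) h -> A <= B -> C <= D ->
  exists e, primitive W h (rect U f A B C D) e.
Proof.
  intros HC HW Hh HAB HCD.
  apply (cousin (fun a b => exists e, primitive W h (rect U f a b C D) e)); auto.
  { intros a b c Ha Hab Hbc Hc H1 H2. now apply rect_glue with g b. }
  intros x Hx.
  enough (Hd : exists d, 0 < d /\ forall a b, a <= x -> x <= b -> b - a < d ->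
            exists e, primitive W h (rect U f a b C D) e).
  { destruct Hd as [d [Hd H]]. exists d. split; auto. }
  (* The inner induction carries a strip width [r], shrunk at each gluing. *)
  apply (cousin (fun c d => exists r, 0 < r /\ forall a b, a <= x -> x <= b -> b - a < r ->
            exists e, primitive W h (rect U f a b c d) e)); auto.
  - intros c m d _ H1 H2 _ [r [Hr Hr']] [s [Hs Hs']].
    exists (Rmin r s). split; [now apply Rmin_glb_lt |].
    intros a b Ha Hb Hab. pose proof (Rmin_l r s). pose proof (Rmin_r r s).
    destruct (Hr' a b) as [e1 He1], (Hs' a b) as [e2 He2]; auto; try lra.
    destruct (rect_glue U _ _ W h c m d a b (chart_swap U f g HC)) as [e He]; auto.
    + exists e1. eapply primitive_sub; [| exact He1]. unfold rect; simpl; tauto.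
    + exists e2. eapply primitive_sub; [| exact He2]. unfold rect; simpl; tauto.
    + exists e. eapply primitive_sub; [| exact He]. unfold rect; simpl; tauto.
  - intros y Hy. destruct (primitive_local W h (g (x, y)) HW Hh) as (r & Hr & e & He).
    destruct HC as (_ & _ & Hg & Hgf & Hfg).
    destruct (Hg (x, y) r Hr) as [d [Hd Hd']].
    exists (d / 2). split; [lra |]. intros c c' _ Hc Hc' _ Hcc.
    exists (d / 2). split; [lra |]. intros a b Ha Hb Hab.
    exists e. eapply primitive_sub; [| exact He]. intros z [Uz [H1 H2]].
    rewrite <- (Hgf z Uz). apply Hd'. eapply Rle_lt_trans; [apply euclid_le |].
    simpl. assert (Rabs (x - fst (f z)) < d / 2) by (apply Rabs_def1; lra).
    assert (Rabs (y - snd (f z)) < d / 2) by (apply Rabs_def1; lra). lra.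
Qed.

(** The radius is chosen before [W] and [h]; this uniformity makes the later bound on the number of
    classes depend on [M] alone. *)
Definition loc_trivial (M : MetricSpace) : Prop :=
  forall x : M, exists r, 0 < r /\ forall W h : M -> bool,
    open_pred W -> locconst (frontier W) h ->
    exists c, primitive W h (fun y => dist x y < r) c.

Lemma surface_chart (M : MetricSpace) (x : M) :
  locally_euclidean_2 M -> exists U f g, chart U f g /\ U x.
Proof.
  intros H. destruct (H x) as (U & HU & Ux & f & g & Hf & Hg & Hgf & Hfg).
  exists U, f, g. repeat split; auto; apply Hfg.
Qed.

Lemma surface_loc_trivial (M : MetricSpace) : locally_euclidean_2 M -> loc_trivial M.
Proof.
  intros HM x. destruct (surface_chart M x HM) as (U & f & g & HC & Ux).
  destruct (chart_square_open U f g (f x) 1 HC x) as [r [Hr Hr']].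
  { rewrite !Rminus_diag, Rabs_R0. repeat split; auto; lra. }
  exists r. split; auto. intros W h HW Hh.
  destruct (rect_primitive U f g W h (fst (f x) - 1) (fst (f x) + 1)
              (snd (f x) - 1) (snd (f x) + 1) HC HW Hh) as [e He]; try lra.
  exists e. eapply primitive_sub; [| exact He]. intros y Hy.
  destruct (Hr' y Hy) as (Uy & H1 & H2). apply Rabs_def2 in H1, H2.
  split; auto. lra.
Qed.

Lemma Rabs_convex (x p q t e : R) :
  Rabs (x - p) < e -> Rabs (x - q) < e -> 0 <= t <= 1 ->
  Rabs (x - (p + t * (q - p))) < e.
Proof.
  intros Hp Hq Ht.
  replace (x - (p + t * (q - p))) with ((1 - t) * (x - p) + t * (x - q)) by ring.
  eapply Rle_lt_trans; [apply Rabs_triang |].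
  rewrite !Rabs_mult, (Rabs_pos_eq t), (Rabs_pos_eq (1 - t)) by lra.
  destruct (Rle_dec (Rabs (x - p)) (Rabs (x - q))); nra.
Qed.

Lemma surface_loc_connected (M : MetricSpace) : locally_euclidean_2 M -> loc_connected M.
Proof.
  intros HM x r Hr. destruct (surface_chart M x HM) as (U & f & g & HC & Ux).
  destruct (HC) as (HU & Hf & Hg & Hgf & Hfg).
  destruct (Hg (f x) r Hr) as [d [Hd Hd']].
  exists (fun y => U y /\ Rabs (fst (f x) - fst (f y)) < d / 2 /\
                          Rabs (snd (f x) - snd (f y)) < d / 2).
  repeat split; auto.
  - now apply chart_square_open with g.
  - apply (chart_convex_conn U f g (fun p => Rabs (fst (f x) - fst p) < d / 2 /\
                          Rabs (snd (f x) - snd p) < d / 2) HC).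
    intros p q t [H1 H2] [H3 H4] Ht. simpl. split; now apply Rabs_convex.
  - rewrite Rminus_diag, Rabs_R0. lra.
  - rewrite Rminus_diag, Rabs_R0. lra.
  - intros y (Uy & H1 & H2). rewrite <- (Hgf x Ux), <- (Hgf y Uy).
    rewrite (Hgf x Ux) at 1. rewrite <- (Hgf x Ux) at 1. apply Hd'.
    eapply Rle_lt_trans; [apply euclid_le |]. lra.
Qed.

(** * Finiteness of the first cohomology *)

(* Local primitives are compared at finitely many base points, so the list of their
   values there determines the class of [h] in H^1(M; Z/2). *)
Lemma finitely_many_classes (M : MetricSpace) :
  compact M (fun _ => True) -> loc_connected M -> loc_trivial M ->
  exists n, forall W : M -> bool, open_pred W ->
  exists Ts : list ((M -> bool) -> bool), length Ts = n /\
    forall h k, locconst (frontier W) h -> locconst (frontier W) k ->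
      (forall T, In T Ts -> T h = T k) ->
      exists c, primitive W (fun x => xorb (h x) (k x)) (fun _ => True) c.
Proof.
  intros HM HL HT.
  set (good := fun i : M * R => 0 < snd i /\ forall W h : M -> bool,
    open_pred W -> locconst (frontier W) h ->
    exists c, primitive W h (fun y => dist (fst i) y < snd i) c).
  destruct (HM _ (fun i y => good i /\ dist (fst i) y < snd i / 2)) as [L HLc].
  { intros i y [Hi Hy]. destruct (ball_open (fst i) (snd i / 2) y Hy) as [r [Hr Hr']].
    exists r. auto. }
  { intros x _. destruct (HT x) as [r [Hr Hr']]. exists (x, r).
    unfold good. simpl. rewrite dist_self. repeat split; auto. lra. }
  (* With [rho] at most a quarter of every good radius, a set within [rho] of a base point that
     meets a half-radius ball lies in the full ball. *)
  destruct (list_radius L (fun i rho => good i -> rho <= snd i / 4)) as [rho [Hrho HrhoL]].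
  { intros i r r' H Hr Hi. specialize (H Hi). lra. }
  { intros i _. destruct (classic (good i)) as [Hi | Hi].
    - destruct (Hi) as [H _]. exists (snd i / 4). split; [lra |]. intros; lra.
    - exists 1. split; [lra |]. tauto. }
  set (valid := fun e : M * (M -> Prop) => is_open M (snd e) /\ conn (snd e) /\
    snd e (fst e) /\ forall z, snd e z -> dist (fst e) z < rho).
  destruct (HM _ (fun e y => valid e /\ snd e y)) as [E HE].
  { intros e y [He Hy]. destruct (He) as [HO _]. destruct (HO y Hy) as [r [Hr Hr']].
    exists r. auto. }
  { intros x _. destruct (HL x rho Hrho) as (O & H1 & H2 & H3 & H4).
    exists (x, O). split; auto. unfold valid. simpl. auto. }
  exists (length (list_prod L E)). intros W HW.
  (* [C] fixes one local primitive for every good ball and every cocycle on [W]. *)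
  destruct (choice (fun (p : (M * R) * (M -> bool)) c =>
    good (fst p) -> locconst (frontier W) (snd p) ->
    primitive W (snd p) (fun y => dist (fst (fst p)) y < snd (fst p)) c)) as [C HC].
  { intros [i h]. simpl. destruct (classic (good i /\ locconst (frontier W) h)) as [[Hi Hh] | H].
    - destruct (Hi) as [_ Hi']. destruct (Hi' W h HW Hh) as [c Hc]. eauto.
    - exists (fun _ => true). tauto. }
  (* The invariants are the values of these primitives at the base points; the two covers fix their
     number. *)
  exists (map (fun p h => C (fst p, h) (fst (snd p))) (list_prod L E)).
  split; [apply length_map |].
  intros h k Hh Hk HTs.
  set (d := fun i x => xorb (C (i, h) x) (C (i, k) x)).
  assert (Hd : forall i, good i -> primitive W (fun x => xorb (h x) (k x))
                 (fun y => dist (fst i) y < snd i) (d i)).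
  { intros i Hi. apply primitive_xor; [apply (HC (i, h)) | apply (HC (i, k))]; auto. }
  assert (Hd0 : forall i e, In i L -> In e E -> d i (fst e) = false).
  { intros i e Hi He. unfold d.
    rewrite (HTs (fun h => C (i, h) (fst e))); [apply xorb_nilpotent |].
    apply in_map_iff. exists (i, e). split; auto. now apply in_prod. }
  (* On the small connected set around [y] the sum of [d i] and [d j] is locally constant, and it
     vanishes at the base point. *)
  assert (Hagree : forall i j y, In i L -> In j L -> good i -> good j ->
            dist (fst i) y < snd i / 2 -> dist (fst j) y < snd j / 2 -> d i y = d j y).
  { intros i j y Li Lj Gi Gj Hi Hj.
    destruct (HE y I) as (e & Le & (_ & HOc & HOe & HOr) & HOy).
    assert (Hin : forall i, In i L -> good i -> dist (fst i) y < snd i / 2 ->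
              forall z, snd e z -> dist (fst i) z < snd i).
    { intros i' Li' Gi' Hi' z Hz. specialize (HrhoL i' Li' Gi').
      pose proof (HOr y HOy). pose proof (HOr z Hz).
      pose proof (dist_tri M (fst i') y z). pose proof (dist_tri M y (fst e) z).
      rewrite (dist_sym M y (fst e)) in *. lra. }
    assert (Hlc : locconst (snd e) (fun x => xorb (d i x) (d j x))).
    { eapply locconst_sub;
        [| exact (primitive_diff _ _ _ _ _ _ (Hd i Gi) (Hd j Gj))].
      intros z Hz. split; apply Hin; auto. }
    pose proof (HOc _ Hlc y (fst e) HOy HOe) as Eq. simpl in Eq.
    rewrite !Hd0 in Eq; auto. now apply xorb_eq. }
  destruct (choice (fun x i => In i L /\ good i /\ dist (fst i) x < snd i / 2)) as [a Ha].
  { intros x. destruct (HLc x I) as (i & Li & Gi & Hi). eauto. }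
  exists (fun x => d (a x) x). intros x _.
  destruct (Ha x) as (Lx & Gx & Hx). destruct (Gx) as [Rx _].
  destruct (Hd (a x) Gx x) as [r [Hr Hr']]; [lra |].
  exists (Rmin r (snd (a x) / 2 - dist (fst (a x)) x)).
  split; [apply Rmin_glb_lt; lra |]. intros y _ Hy.
  pose proof (Rmin_l r (snd (a x) / 2 - dist (fst (a x)) x)).
  pose proof (Rmin_r r (snd (a x) / 2 - dist (fst (a x)) x)).
  pose proof (dist_tri M (fst (a x)) x y).
  destruct (Ha y) as (Ly & Gy & Hya).
  rewrite (Hagree (a y) (a x) y); auto; try lra. apply Hr'; lra.
Qed.

(* [W] is the union of the domains whose boundary misses [B]; a global primitive is
   constant on the connected set [X], which is disjoint from [W], and on each domain. *)
Lemma boundary_classes (M : MetricSpace) :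
  compact M (fun _ => True) -> loc_connected M -> loc_trivial M ->
  exists n, forall X B : M -> Prop, is_open M (fun x => ~ X x) -> conn X -> is_open M B ->
  exists Ts : list ((M -> bool) -> bool), length Ts = n /\
    forall h k, locconst (fun x => X x /\ ~ B x) h -> locconst (fun x => X x /\ ~ B x) k ->
      (forall T, In T Ts -> T h = T k) ->
      forall U, complementary_domain M X U -> (forall u, boundary M U u -> ~ B u) ->
      forall u v, boundary M U u -> boundary M U v ->
        xorb (h u) (k u) = xorb (h v) (k v).
Proof.
  intros HM HL HT. destruct (finitely_many_classes M HM HL HT) as [n Hn].
  exists n. intros X B Xcl HX HB.
  set (W := fun y => asb (exists U, complementary_domain M X U /\
              (forall u, boundary M U u -> ~ B u) /\ U y)).
  assert (HW : open_pred W).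
  { intros x Hx. unfold W in Hx. rewrite asb_true in Hx. destruct Hx as (U & HU & HUB & Ux).
    destruct (domain_open X U HL Xcl HU x Ux) as [r [Hr Hr']]. exists r. split; auto.
    intros y Hy. apply asb_true. exists U. auto. }
  (* A frontier point off [X] would lie in a domain that meets [W], hence in [W]. Around one in [B],
     a small connected neighbourhood inside [B] would meet the boundary of a domain in [W]. *)
  assert (HWb : forall x, frontier W x -> X x /\ ~ B x).
  { intros x [Wx Hx]. assert (Xx : X x).
    { apply NNPP. intros Xx.
      destruct (component_through (fun z => ~ X z) x Xx) as [V [HV Vx]].
      destruct (domain_open X V HL Xcl HV x Vx) as [r [Hr Hr']].
      destruct (Hx r Hr) as [z [Hz Wz]]. unfold W in Wz. rewrite asb_true in Wz.
      destruct Wz as (U & HU & HUB & Uz).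
      apply diff_true_false. rewrite <- Wx. symmetry. apply asb_true. exists U.
      refine (conj HU (conj HUB _)). apply (domain_unique X V U z); auto. }
    split; auto. intros Bx. destruct (HB x Bx) as [r [Hr Hr']].
    destruct (HL x r Hr) as (O & HO1 & HO2 & Ox & HO).
    destruct (HO1 x Ox) as [s [Hs Hs']].
    destruct (Hx s Hs) as [z [Hz Wz]]. unfold W in Wz. rewrite asb_true in Wz.
    destruct Wz as (U & HU & HUB & Uz).
    destruct (conn_meets_boundary O U z x) as [u [Ou Hu]]; auto.
    - intros Ux. now apply (domain_out X U x).
    - apply (HUB u Hu). auto. }
  destruct (Hn W HW) as (Ts & Hlen & HTs). exists Ts. split; auto.
  intros h k Hh Hk Heq U HU HUB.
  destruct (HTs h k (locconst_sub _ _ h HWb Hh) (locconst_sub _ _ k HWb Hk) Heq) as [c Hc].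
  assert (WX : forall x, X x -> W x = false).
  { intros x Xx. apply asb_false. intros (V & HV & _ & Vx). now apply (domain_out X V x). }
  assert (WU : forall x, U x -> W x = true).
  { intros x Ux. apply asb_true. exists U. auto. }
  (* Where [W] is constant the cocycle vanishes, so the primitive is locally constant. *)
  assert (Hlc : forall (A : M -> Prop) b, (forall x, A x -> W x = b) -> locconst A c).
  { intros A b HA x Ax. destruct (Hc x I) as [r [Hr Hr']]. exists r. split; auto.
    intros y Ay Hy. rewrite (Hr' y I Hy), (HA x Ax), (HA y Ay).
    destruct b; simpl; now rewrite xorb_false_r. }
  destruct (HU) as ([w Uw] & _).
  (* Stepping from a boundary point [u] into [U] changes the primitive by [h u + k u]; its values on
     [X] and on [U] are constant, so this sum does not depend on [u]. *)
  assert (E : forall u v, X u -> boundary M U u -> X v ->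
            c w = xorb (c v) (xorb (h u) (k u))).
  { intros u v Xu [Hu _] Xv. destruct (Hc u I) as [r [Hr Hr']].
    destruct (Hu r Hr) as [z [Uz Hz]]. specialize (Hr' z I Hz).
    rewrite (WX u Xu), (WU z Uz) in Hr'. simpl in Hr'.
    rewrite (HX c (Hlc X false WX) v u Xv Xu), <- Hr'.
    now apply (domain_conn X U HU c (Hlc U true WU)). }
  intros u v Hu Hv.
  assert (Xu := domain_boundary X U u HL Xcl HU Hu).
  assert (Xv := domain_boundary X U v HL Xcl HU Hv).
  pose proof (E u u Xu Hu Xu) as E1. pose proof (E v u Xv Hv Xu) as E2.
  rewrite E1 in E2.
  destruct (c u), (xorb (h u) (k u)), (xorb (h v) (k v)); simpl in E2; congruence.
Qed.

(** * Pigeonhole, and domains whose boundary joins two open sets *)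

(** The test [t] splits the list, and one part still has more than [2 ^ length ts] entries for the
    remaining tests. *)
Lemma two_agree {A : Type} (ts : list (A -> bool)) : forall l : list A, NoDup l ->
  (2 ^ length ts < length l)%nat ->
  exists x y, In x l /\ In y l /\ x <> y /\ forall t, In t ts -> t x = t y.
Proof.
  induction ts as [|t ts IH]; intros l Hl Hlen.
  - simpl in Hlen. destruct l as [|x [|y l]]; simpl in Hlen; try lia.
    exists x, y. simpl. repeat split; auto; [| tauto].
    inversion Hl; subst. intros ->. apply H1. now left.
  - simpl in Hlen.
    assert (Hcount : (length (filter t l) + length (filter (fun x => negb (t x)) l) = length l)%nat)
      by apply filter_length.
    assert (Hgo : forall f : A -> bool,
      (forall x y, f x = true -> f y = true -> t x = t y) ->
      (2 ^ length ts < length (filter f l))%nat ->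
      exists x y, In x l /\ In y l /\ x <> y /\ forall t', In t' (t :: ts) -> t' x = t' y).
    { intros f Hf Hlt. destruct (IH (filter f l)) as (x & y & Hx & Hy & Hxy & Hts); auto.
      - now apply NoDup_filter.
      - apply filter_In in Hx, Hy. destruct Hx, Hy.
        exists x, y. repeat split; auto. intros t' [<- | Ht']; auto. }
    destruct (Nat.lt_ge_cases (2 ^ length ts) (length (filter t l))).
    + apply (Hgo t); auto. intros x y. congruence.
    + apply (Hgo (fun x => negb (t x))); [| lia].
      intros x y Hx Hy. apply negb_true_iff in Hx, Hy. congruence.
Qed.

Lemma NoDup_third {A : Type} (l : list A) x y :
  NoDup l -> (2 < length l)%nat -> exists z, In z l /\ z <> x /\ z <> y.
Proof.
  intros Hl Hlen. apply NNPP. intros Hno.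
  assert (Hinc : incl l [x; y]).
  { intros z Hz. destruct (classic (z = x)) as [-> | H1]; [now left |].
    destruct (classic (z = y)) as [-> | H2]; [right; now left |]. exfalso. eauto. }
  apply NoDup_incl_length in Hinc; auto. simpl in Hinc. lia.
Qed.

(** Otherwise every domain meeting a connected open [O] inside [V2] has boundary points in [O], so
    its boundary misses [V1] and [h] is constant on it. Filling in these constants extends [h] to a
    locally constant function on [O], although it is 1 at [a] and 0 at [s]. *)
Lemma domain_boundary_joins (M : MetricSpace) (X V1 V2 : M -> Prop) :
  compact M (fun _ => True) -> loc_connected M -> loc_trivial M ->
  indecomposable M X -> is_open M V1 -> is_open M V2 ->
  (forall x, V1 x -> V2 x -> False) ->
  (exists x, X x /\ V1 x) -> (exists x, X x /\ V2 x) ->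
  exists U u v, complementary_domain M X U /\
    boundary M U u /\ V1 u /\ boundary M U v /\ V2 v.
Proof.
  intros HM HL HT Hind HV1 HV2 Hdisj [p [Xp V1p]] [q [Xq V2q]].
  destruct (Hind) as [(_ & HXc & HX) _]. apply connected_conn in HX.
  assert (Xcl := compact_closed X HXc).
  destruct (boundary_classes M HM HL HT) as [n Hn].
  destruct (Hn X V1 Xcl HX HV1) as (Ts & Hlen & HTs).
  destruct (HV2 q V2q) as [r [Hr Hr']].
  destruct (HL q r Hr) as (O & HO1 & HO2 & Oq & HO).
  assert (OV2 : forall z, O z -> V2 z) by (intros z Oz; auto).
  (* More than [2 ^ n] points for the pigeonhole, and at least three, so that some [s] other than
     [a] and [b] remains. *)
  destruct (separated_points X [V1] (2 ^ n + 2) Hind) with (G := O)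
    as (l & Hll & Hl & HlX & Hsep); eauto.
  { exists p, q. repeat split; auto. intros ->. eauto. }
  { intros B [<- | []]. split; eauto. }
  destruct (Hsep V1 (or_introl eq_refl)) as [H HH].
  assert (Hpow : (0 < 2 ^ n)%nat) by (apply Nat.neq_0_lt_0, Nat.pow_nonzero; lia).
  destruct (two_agree (map (fun T x => T (H x)) Ts) l) as (a & b & Ha & Hb & Hab & Heq); auto.
  { rewrite length_map, Hlen, Hll. lia. }
  destruct (NoDup_third l a b) as (s & Hs & Hsa & Hsb); auto.
  { rewrite Hll. lia. }
  destruct (HH a Ha) as [Hla Hva]. destruct (HH b Hb) as [Hlb Hvb].
  set (h := fun x => xorb (H a x) (H b x)).
  assert (hloc : locconst (fun x => X x /\ ~ V1 x) h) by now apply (locconst_op xorb).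
  apply NNPP. intros Hno.
  assert (hconst : forall U y, complementary_domain M X U -> O y -> U y ->
     forall x, O x -> X x -> exists u, O u /\ X u /\ boundary M U u /\
       forall v, boundary M U v -> h v = h u).
  { intros U y HU Oy Uy x Ox Xx.
    destruct (conn_meets_boundary O U y x) as [u [Ou Hu]]; auto.
    - intros Ux. now apply (domain_out X U x).
    - exists u. split; auto. split; [now apply domain_boundary with U |].
      split; auto. intros v Hv.
      apply (HTs (H a) (H b) Hla Hlb) with (U := U); auto.
      + intros T HTin. apply (Heq (fun x => T (H x))). apply in_map_iff. eauto.
      + intros w Hw V1w. apply Hno. exists U, w, u. auto 6. }
  (* On a domain meeting [O], [phi] is the common value of [h] on its boundary. *)
  set (phi := fun z => if asb (X z) then h z else
     asb (exists U u, complementary_domain M X U /\ U z /\ boundary M U u /\ h u = true)).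
  assert (phiX : forall z, X z -> phi z = h z).
  { intros z Xz. unfold phi. now rewrite (proj2 (asb_true _) Xz). }
  assert (phiU : forall U z u, complementary_domain M X U -> O z -> U z ->
            boundary M U u -> phi z = h u).
  { intros U z u HU Oz Uz Hu. unfold phi.
    rewrite (proj2 (asb_false (X z))) by now apply domain_out with U.
    destruct (hconst U z HU Oz Uz q Oq Xq) as (w & Ow & Xw & Hw & Hc).
    destruct (h u) eqn:E.
    - apply asb_true. exists U, u. auto.
    - apply asb_false. intros (V & v & HV & Vz & Hv & Ev).
      destruct (hconst V z HV Oz Vz q Oq Xq) as (w' & _ & _ & Hw' & Hc').
      (* [U] and [V] share [z] and so have the same points; being predicates, they are compared
         pointwise. *)
      assert (EUV : forall x, boundary M V x -> boundary M U x).
      { intros x [Hx1 Hx2]. split.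
        - intros e He. destruct (Hx1 e He) as [y [Vy Hy]]. exists y. split; auto.
          apply (domain_unique X V U z); auto.
        - intros [e [He Hi]]. apply Hx2. exists e. split; auto.
          intros y Hy. apply (domain_unique X U V z); auto. }
      rewrite (Hc v (EUV v Hv)), <- (Hc u Hu) in Ev. congruence. }
  assert (Hphi : locconst O phi).
  { intros z Oz. destruct (HO1 z Oz) as [e [He He']].
    destruct (classic (X z)) as [Xz | Xz].
    - assert (Fz : X z /\ ~ V1 z) by (split; eauto).
      destruct (hloc z Fz) as [d [Hd Hd']].
      (* For [y] near [z] and off [X], the small connected [N] contains a boundary point [u] of the
         domain of [y]; then [phi y = h u], and [h u = h z] because [u] is near [z]. *)
      destruct (HL z (Rmin d e)) as (N & HN1 & HN2 & Nz & HN).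
      { now apply Rmin_glb_lt. }
      pose proof (Rmin_l d e). pose proof (Rmin_r d e).
      destruct (HN1 z Nz) as [s' [Hs' Hs'']]. exists s'. split; auto.
      intros y Oy Hy. assert (Ny := Hs'' y Hy). rewrite (phiX z Xz).
      destruct (classic (X y)) as [Xy | Xy].
      + rewrite (phiX y Xy). apply Hd'; [split; eauto |]. specialize (HN y Ny). lra.
      + destruct (component_through (fun z => ~ X z) y Xy) as [U [HU Uy]].
        destruct (conn_meets_boundary N U y z) as [u [Nu Hu]]; auto.
        { intros Uz. now apply (domain_out X U z). }
        rewrite (phiU U y u); auto. specialize (HN u Nu).
        assert (Ou : O u) by (apply He'; lra).
        apply Hd'; [| lra]. split; eauto. now apply domain_boundary with U.
    - destruct (component_through (fun z => ~ X z) z Xz) as [U [HU Uz]].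
      destruct (domain_open X U HL Xcl HU z Uz) as [d [Hd Hd']].
      exists d. split; auto. intros y Oy Hy.
      destruct (hconst U z HU Oz Uz q Oq Xq) as (w & _ & _ & Hw & _).
      rewrite (phiU U y w), (phiU U z w); auto. }
  destruct (HlX a Ha) as [Xa Oa], (HlX s Hs) as [Xs Os].
  pose proof (HO2 phi Hphi a s Oa Os) as E.
  rewrite (phiX a Xa), (phiX s Xs) in E. unfold h in E.
  rewrite !Hva, !Hvb in E; auto.
  rewrite (proj2 (asb_true (a = a))), (proj2 (asb_false (a = b))),
    (proj2 (asb_false (s = a))), (proj2 (asb_false (s = b))) in E; auto.
  discriminate.
Qed.

(** * Domains with dense boundary, and passage to the limit *)

Lemma boundary_nonempty (M : MetricSpace) (X U : M -> Prop) p :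
  connected M (fun _ => True) -> complementary_domain M X U -> X p ->
  exists u, boundary M U u.
Proof.
  intros HM HU Xp. apply connected_conn in HM. destruct (HU) as ([y Uy] & _).
  destruct (conn_meets_boundary (fun _ => True) U y p) as [u [_ Hu]]; auto.
  - intros Up. now apply (domain_out X U p).
  - now exists u.
Qed.

Lemma exists_dense_boundary (M : MetricSpace) (X : M -> Prop) eps :
  compact M (fun _ => True) -> loc_connected M -> loc_trivial M ->
  indecomposable M X -> (exists x y, X x /\ X y /\ x <> y) -> 0 < eps ->
  exists U, complementary_domain M X U /\
    forall y, X y -> exists x, boundary M U x /\ dist x y < eps.
Proof.
  intros HM HL HT Hind Hnt Heps.
  destruct (Hind) as [(HXn & HXc & HX) _]. apply connected_conn in HX.
  assert (Xcl := compact_closed X HXc).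
  destruct (boundary_classes M HM HL HT) as [n Hn].
  apply NNPP. intros Hno.
  (* With radius [eps / 2], a boundary that meets every ball of a finite cover of [X] is [eps]-dense
     in [X]. *)
  set (B := fun b y : M => dist b y < eps / 2).
  assert (HB : forall b, is_open M (B b)) by (intros b; apply ball_open).
  destruct (HXc {b | X b} (fun b y => B (proj1_sig b) y)) as [Bl HBl].
  { intros b. apply HB. }
  { intros x Xx. exists (exist _ x Xx). unfold B. simpl. rewrite dist_self. lra. }
  set (Bs := map (@proj1_sig _ _) Bl).
  assert (HBX : forall b, In b Bs -> X b).
  { intros b Hb. apply in_map_iff in Hb. destruct Hb as [[b' Hb'] [<- _]]. auto. }
  assert (Hmiss : forall U, complementary_domain M X U ->
            exists b, In b Bs /\ forall u, boundary M U u -> ~ B b u).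
  { intros U HU. apply NNPP. intros Hall. apply Hno. exists U. split; auto.
    intros y Xy. destruct (HBl y Xy) as ([b Xb] & Hb & Hby). simpl in Hby.
    assert (Hu : exists u, boundary M U u /\ B b u).
    { apply NNPP. intros Hu. apply Hall. exists b. split; [| eauto].
      apply in_map_iff. now exists (exist _ b Xb). }
    destruct Hu as [u [Hu Bu]]. exists u. split; auto. unfold B in *.
    pose proof (dist_tri M u b y). rewrite (dist_sym M u b) in *. lra. }
  destruct (choice (fun b (Ts : list ((M -> bool) -> bool)) => length Ts = n /\
    forall h k, locconst (fun x => X x /\ ~ B b x) h -> locconst (fun x => X x /\ ~ B b x) k ->
      (forall T, In T Ts -> T h = T k) ->
      forall U, complementary_domain M X U -> (forall u, boundary M U u -> ~ B b u) ->
      forall u v, boundary M U u -> boundary M U v ->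
        xorb (h u) (k u) = xorb (h v) (k v))) as [Ts HTs].
  { intros b. now apply Hn. }
  (* The pigeonhole runs over the invariants of all balls at once, so that one pair serves every
     ball; the 2 also guarantees a third point. *)
  set (N := (2 ^ (length Bs * n) + 2)%nat).
  destruct (separated_points X (map B Bs) N Hind Hnt) with (G := fun _ : M => True)
    as (l & Hll & Hl & HlX & Hsep).
  { intros B' HB'. apply in_map_iff in HB'. destruct HB' as (b & <- & Hb).
    split; auto. exists b. split; auto. unfold B. rewrite dist_self. lra. }
  { intros x _. exists 1. split; [lra | auto]. }
  { destruct HXn as [x Xx]. eauto. }
  destruct (choice (fun b (H : M -> M -> bool) => In b Bs -> forall x, In x l ->
      locconst (fun z => X z /\ ~ B b z) (H x) /\
      forall y, In y l -> H x y = asb (y = x))) as [H HH].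
  { intros b. destruct (classic (In b Bs)) as [Hb |]; [| exists (fun _ _ => true); tauto].
    destruct (Hsep (B b)) as [H HH]; [now apply in_map | eauto]. }
  assert (Hlen : forall bs, length (flat_map (fun b => map (fun T x => T (H b x)) (Ts b)) bs)
                   = (length bs * n)%nat).
  { induction bs as [|b bs IH]; simpl; auto.
    rewrite length_app, length_map, IH. now rewrite (proj1 (HTs b)). }
  assert (Hpow : (0 < 2 ^ (length Bs * n))%nat) by (apply Nat.neq_0_lt_0, Nat.pow_nonzero; lia).
  destruct (two_agree (flat_map (fun b => map (fun T x => T (H b x)) (Ts b)) Bs) l)
    as (a & a' & Ha & Ha' & Haa & Heq); auto.
  { rewrite Hlen, Hll. unfold N. lia. }
  destruct (NoDup_third l a a') as (s & Hs & Hsa & Hsa'); auto.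
  { rewrite Hll. unfold N. lia. }
  set (h := fun b x => xorb (H b a x) (H b a' x)).
  assert (hloc : forall b, In b Bs -> locconst (fun x => X x /\ ~ B b x) (h b)).
  { intros b Hb. apply (locconst_op xorb); now apply HH. }
  assert (hU : forall b U, In b Bs -> complementary_domain M X U ->
            (forall u, boundary M U u -> ~ B b u) ->
            forall u v, boundary M U u -> boundary M U v -> h b u = h b v).
  { intros b U Hb HU HUB u v Hu Hv.
    apply (proj2 (HTs b) (H b a) (H b a')) with (U := U); auto; try now apply HH.
    intros T HTin. apply (Heq (fun x => T (H b x))). apply in_flat_map.
    exists b. split; auto. apply in_map_iff. eauto. }
  (* Near [t] each [h b] is constant on [X] outside its ball; when [t] lies in [B b], a small radius
     leaves no such points. *)
  assert (hV : forall t, In t l -> exists r, 0 < r /\ forall b, In b Bs ->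
            forall z, X z -> ~ B b z -> dist t z < r -> h b z = h b t).
  { intros t Ht. destruct (HlX t Ht) as [Xt _].
    apply (list_radius Bs (fun b r => forall z, X z -> ~ B b z -> dist t z < r -> h b z = h b t)).
    - intros b r r' H1 H2 z Xz Bz Hz. apply H1; auto. lra.
    - intros b Hb. destruct (classic (B b t)) as [Bt | Bt].
      + destruct (HB b t Bt) as [r [Hr Hr']]. exists r. split; auto.
        intros z Xz Bz Hz. exfalso. auto.
      + destruct (hloc b Hb t (conj Xt Bt)) as [r [Hr Hr']]. exists r. split; auto. }
  destruct (hV a Ha) as [r [Hr Hr']]. destruct (hV s Hs) as [r2 [Hr2 Hr2']].
  assert (Hds : 0 < dist a s) by (apply dist_gt0; congruence).
  destruct (HlX a Ha) as [Xa _], (HlX s Hs) as [Xs _].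
  assert (Hmin : forall x, 0 < x -> 0 < Rmin x (dist a s / 2)).
  { intros x Hx. apply Rmin_glb_lt; lra. }
  (* Capping the radii at half the distance from [a] to [s] makes the two balls disjoint. *)
  destruct (domain_boundary_joins M X (fun z => dist a z < Rmin r (dist a s / 2))
     (fun z => dist s z < Rmin r2 (dist a s / 2))) as (U & u & v & HU & Hu & Vu & Hv & Vv);
    auto using ball_open.
  { intros x H1 H2. pose proof (Rmin_r r (dist a s / 2)). pose proof (Rmin_r r2 (dist a s / 2)).
    pose proof (dist_tri M a x s). rewrite (dist_sym M x s) in *. lra. }
  { exists a. rewrite dist_self. auto. }
  { exists s. rewrite dist_self. auto. }
  (* The boundary of the joining domain misses some [B b], so [h b] is constant on it, yet it is 1
     at [u] near [a] and 0 at [v] near [s]. *)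
  destruct (Hmiss U HU) as (b & Hb & HUB).
  pose proof (Rmin_l r (dist a s / 2)). pose proof (Rmin_l r2 (dist a s / 2)).
  pose proof (hU b U Hb HU HUB u v Hu Hv) as E.
  rewrite (Hr' b Hb u), (Hr2' b Hb v) in E; auto; try lra;
    try (now apply domain_boundary with U).
  unfold h in E.
  rewrite !(proj2 (HH b Hb a Ha)), !(proj2 (HH b Hb a' Ha')) in E; auto.
  rewrite (proj2 (asb_true (a = a))), (proj2 (asb_false (a = a'))),
    (proj2 (asb_false (s = a))), (proj2 (asb_false (s = a'))) in E; auto.
  discriminate.
Qed.

Theorem mainTheorem5 (S : MetricSpace) (X : S -> Prop)
  (hS : closed_surface S) (hX : indecomposable S X) :
  exists U : nat -> S -> Prop,
    (forall n, complementary_domain S X (U n)) /\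
    hausdorff_converges S (fun n => boundary S (U n)) X.
Proof.
  destruct hS as (_ & HM & HMc & HE).
  assert (HL := surface_loc_connected S HE). assert (HT := surface_loc_trivial S HE).
  destruct (hX) as [([p Xp] & HXc & _) _].
  assert (Xcl := compact_closed X HXc).
  assert (Hdense : forall eps, 0 < eps -> exists U, complementary_domain S X U /\
    forall y, X y -> exists x, boundary S U x /\ dist x y < eps).
  { intros eps Heps. destruct (classic (exists x y, X x /\ X y /\ x <> y)) as [Hnt | Hnt].
    - now apply exists_dense_boundary.
    (* Degenerate case [X = {p}]: a chart onto the plane shows that the surface has another point,
       and the boundary of its domain is nonempty and lies in [{p}]. *)
    - assert (Xeq : forall x, X x -> x = p).
      { intros x Xx. apply NNPP. intros Hne. apply Hnt. exists x, p. auto. }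
      assert (Hq : exists q, ~ X q).
      { apply NNPP. intros Hq.
        destruct (surface_chart S p HE) as (V & f & g & (_ & _ & _ & _ & Hfg) & _).
        assert (Hall : forall z, z = p).
        { intros z. apply Xeq. apply NNPP. eauto. }
        destruct (Hfg (0, 0)) as [_ E0]. destruct (Hfg (1, 0)) as [_ E1].
        rewrite (Hall (g (0, 0))) in E0. rewrite (Hall (g (1, 0))) in E1.
        rewrite E0 in E1. injection E1. lra. }
      destruct Hq as [q Xq].
      destruct (component_through (fun z => ~ X z) q Xq) as [U [HU Uq]].
      destruct (boundary_nonempty S X U p HMc HU Xp) as [u Hu].
      exists U. split; auto. intros y Xy. exists u. split; auto.
      rewrite (Xeq y Xy), (Xeq u (domain_boundary X U u HL Xcl HU Hu)), dist_self. auto. }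
  destruct (choice (fun n U => complementary_domain S X U /\
    forall y, X y -> exists x, boundary S U x /\ dist x y < / (INR n + 1))) as [U HU].
  { intros n. apply Hdense. apply Rinv_0_lt_compat. pose proof (pos_INR n). lra. }
  exists U. split; [intros n; apply HU |].
  intros eps Heps. destruct (archimed_cor1 eps Heps) as [N [HN HN0]].
  exists N. intros n Hn. destruct (HU n) as [HUn Hd]. split.
  (* Boundaries of domains lie in [X], so this half holds at distance 0. *)
  - intros x Hx. exists x. rewrite dist_self. split; auto.
    now apply domain_boundary with (U n).
  - intros y Xy. destruct (Hd y Xy) as [x [Hx Hxy]]. exists x. split; auto.
    eapply Rlt_trans; [exact Hxy |]. eapply Rle_lt_trans; [| exact HN].
    apply Rinv_le_contravar.
    + apply (lt_INR 0); auto.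
    + apply le_INR in Hn. lra.
Qed.
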